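(* Let $(X,d,\mu)$ be a quasiconvex uniform metric measure space that supports a local weak $(1,1)$-Poincar\'e inequality. Then $(X,d)$ is non-amenable if and only if $(X,d,\mu)$ satisfies $(S_{1,1})$.
   Context: A metric measure space $(X,d,\mu)$ is a metric space $(X,d)$ with a Borel regular outer measure $\mu$ such that $\mu(X)>0$ and $\mu(B(x,r))<\infty$ for all $x\in X$, $r>0$; $B(x,r)$ denotes the open ball. It is quasiconvex if there is $Q\ge 1$ such that any $x,y\in X$ are joined by a rectifiable path of length at most $Q\,d(x,y)$. It is uniform if there are non-decreasing functions $f,g\colon(0,\infty)\to(0,\infty)$ with $f(r)\le\mu(B(x,r))\le g(r)$ for all $x\in X$ and $0<r<\infty$. Upper gradients: a Borel function $g\colon X\to[0,\infty]$ is an upper gradient of $u$ if $|u(\gamma(a))-u(\gamma(b))|\le\int_\gamma g\,ds$ for every rectifiable path $\gamma\colon[a,b]\to X$, and a $1$-weak upper gradient if this holds for all rectifiable paths outside a family of $1$-modulus zero. $N^{1,1}(X,d,\mu)$ is the Newton-Sobolev space of (equivalence classes of) integrable functions $u\colon X\to[-\infty,\infty]$ having an integrable upper gradient, and $|\nabla u|$ is the minimal $1$-weak upper gradient of $u$. The space supports a local weak $(1,1)$-Poincar\'e inequality (up to scale $R_P$) if there are $C_P,R_P>0$ and $\tau\ge1$ such that for all balls $B(x,r)\subseteq X$ with $0<r\le R_P$ one has $0<\mu(B(x,\tau r))<\infty$ and $$\frac1{\mu(B(x,r))}\int_{B(x,r)}|u-u_{B(x,r)}|\,d\mu\le C_P\,r\,\frac1{\mu(B(x,\tau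 r))}\int_{B(x,\tau r)}g_u\,d\mu$$ for every $u\colon X\to\mathbb R$ with $u\in L^1(B(x,\tau r),d,\mu)$, where $g_u\colon X\to[0,\infty]$ is its minimal $1$-weak upper gradient and $u_A=\frac1{\mu(A)}\int_A u\,d\mu$. $(X,d,\mu)$ satisfies $(S_{1,1})$ if there exists $C>0$ such that $\int_X|u|\,d\mu\le C\int_X|\nabla u|\,d\mu$ for every $u\in N^{1,1}(X,d,\mu)$ with bounded support. A quasi-lattice in $X$ is a set $\Gamma\subseteq X$ that is cobounded (there is $C>0$ with $\{x\in X: d(x,\Gamma)<C\}=X$) and uniformly locally finite (there is $N\colon(0,\infty)\to\mathbb N$ with $\#(\Gamma\cap B(x,r))\le N(r)$ for every ball $B(x,r)\subseteq X$). A metric space $(X,d)$ with a quasi-lattice $\Gamma\subseteq X$ is amenable if for any $\varepsilon,r>0$ there is a non-empty finite $F\subseteq\Gamma$ with $\#\partial_rF/\#F<\varepsilon$, where $\partial_rF=\{x\in\Gamma: d(x,F)<r\text{ and }d(x,\Gamma\setminus F)<r\}$ (this does not depend on the choice of quasi-lattice; the distance to the empty set is $\infty$). Otherwise $(X,d)$ is non-amenable. *)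

(* Defs.v *)
From HB Require Import structures.
From mathcomp Require Import all_boot all_order all_algebra finmap.
From mathcomp Require Import all_classical all_reals all_analysis.
From mathcomp Require Import measurable_realfun.

Set Implicit Arguments.
Unset Strict Implicit.
Unset Printing Implicit Defensive.

Import Order.TTheory GRing.Theory Num.Theory.
Import numFieldNormedType.Exports.

Local Open Scope classical_set_scope.
Local Open Scope ring_scope.

(* A measurableType is pointed in the library, hence the base point; this is
   no restriction, as a metric measure space is nonempty (0 < mu setT). *)
#[short(type="pmetricType")]
HB.structure Definition PointedMetric (R : numDomainType) :=
  { X of Pointed X & Metric R X }.

Section MetricSpace.
Context {R : realType} (X : pmetricType R).

(* Only the values of the curve on [curve_l, curve_r] are relevant. *)
Record curve := Curve {
  curve_l : R;
  curve_r : R;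
  curve_fun :> R -> X;
  curve_le : curve_l <= curve_r;
  curve_continuous : {within `[curve_l, curve_r], continuous curve_fun} }.

Definition polygonal_length (c : R -> X) (a b : R) (s : seq R) : R :=
  let F := c \o nth b (a :: s) in
  \sum_(0 <= n < size s) mdist (F n) (F n.+1).

Definition length_on (c : R -> X) (a b : R) : \bar R :=
  ereal_sup [set (polygonal_length c a b s)%:E | s in itv_partition a b].

Definition curve_length (c : curve) : \bar R :=
  length_on c (curve_l c) (curve_r c).

Definition rectifiable (c : curve) : Prop := (curve_length c < +oo)%E.

(* Arc-length reparametrization on [0, length]: s is sent to the point c t
   such that c has length s on [curve_l c, t]; c is constant on the set of
   such t, and the largest one is chosen. *)
Definition arc_length_param (c : curve) (s : R) : X :=
  c (sup [set t | curve_l c <= t <= curve_r c /\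
                  length_on c (curve_l c) t = s%:E]).

Definition line_integral (c : curve) (g : X -> \bar R) : \bar R :=
  (\int[lebesgue_measure]_(s in `[0%R, fine (curve_length c)])
     g (arc_length_param c s))%E.

Definition quasiconvex : Prop :=
  exists2 Q : R, 1 <= Q &
    forall x y : X, exists c : curve,
      [/\ rectifiable c, c (curve_l c) = x, c (curve_r c) = y &
          (curve_length c <= (Q * mdist x y)%:E)%E].

Definition dist_to (A : set X) (x : X) : \bar R :=
  ereal_inf [set (mdist x y)%:E | y in A].

Definition quasi_lattice (G : set X) : Prop :=
  (exists2 C : R, 0 < C & [set x | (dist_to G x < C%:E)%E] = setT) /\
  (exists N : R -> nat, forall (x : X) (r : R), 0 < r ->
     (G `&` ball x r #<= `I_(N r))%card).

Definition boundary (G : set X) (r : R) (F : set X) : set X :=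
  [set x | [/\ G x, (dist_to F x < r%:E)%E &
               (dist_to (G `\` F) x < r%:E)%E]].

(* For F finite the boundary of F in a quasi-lattice is finite, so fset_set
   really enumerates it. *)
Definition amenable_lattice (G : set X) : Prop :=
  forall eps r : R, 0 < eps -> 0 < r ->
    exists F : {fset X},
      [/\ F != fset0, [set` F] `<=` G &
          #|` fset_set (boundary G r [set` F])|%:R / #|` F|%:R < eps].

Definition amenable : Prop :=
  exists2 G : set X, quasi_lattice G & amenable_lattice G.

Definition non_amenable : Prop := ~ amenable.

Definition borel_set (A : set X) : Prop := <<s @open X >> A.

Definition borel_fun (g : X -> \bar R) : Prop :=
  measurable_fun setT (g : g_sigma_algebraType (@open X) -> \bar R).

(* |u(x) - u(y)| is infinite as soon as u(x) or u(y) is: in \bar R,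
   `|+oo - +oo| = +oo. A constant curve joins x to x and imposes no condition;
   it has to be excluded only because of the values x where u(x) is infinite. *)
Definition gradient_ineq (u g : X -> \bar R) (c : curve) : Prop :=
  (0 < curve_length c)%E ->
  (`|u (c (curve_l c)) - u (c (curve_r c))| <= line_integral c g)%E.

Definition upper_gradient (u g : X -> \bar R) : Prop :=
  [/\ borel_fun g, forall x, (0 <= g x)%E &
      forall c : curve, rectifiable c -> gradient_ineq u g c].

End MetricSpace.

Section MetricMeasureSpace.
Context {R : realType} (X : pmetricType R).
Variable mu : {outer_measure set X -> \bar R}.

(* mu as a measure on the sigma-algebra of its Caratheodory measurable sets. *)
Definition cara_measure : {measure set (caratheodory_type mu) -> \bar R} := mu.

Local Notation m := cara_measure.

Definition borel_regular : Prop :=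
  (forall A : set X, borel_set A -> mu.-caratheodory A) /\
  (forall A : set X, exists B : set X,
     [/\ borel_set B, A `<=` B & mu B = mu A]).

Definition metric_measure_space : Prop :=
  [/\ borel_regular, (0 < mu setT)%E &
      forall (x : X) (r : R), 0 < r -> (mu (ball x r) < +oo)%E].

Definition uniform_space : Prop :=
  exists f g : R -> R,
    [/\ forall r, 0 < r -> 0 < f r /\ 0 < g r,
        forall r s, 0 < r -> r <= s -> f r <= f s /\ g r <= g s &
        forall (x : X) (r : R), 0 < r ->
          ((f r)%:E <= mu (ball x r) <= (g r)%:E)%E].

Definition modulus_admissible (S : set (curve X)) (rho : X -> \bar R) : Prop :=
  [/\ borel_fun rho, forall x, (0 <= rho x)%E &
      forall c, S c -> rectifiable c -> (1 <= line_integral c rho)%E].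

Definition modulus1 (S : set (curve X)) : \bar R :=
  ereal_inf [set (\int[m]_x rho x)%E | rho in modulus_admissible S].

Definition weak_upper_gradient (u g : X -> \bar R) : Prop :=
  [/\ borel_fun g, forall x, (0 <= g x)%E &
      exists2 S : set (curve X), modulus1 S = 0%E &
        forall c, rectifiable c -> ~ S c -> gradient_ineq u g c].

Definition integrable_on_balls (g : X -> \bar R) : Prop :=
  forall (x : X) (r : R), (\int[m]_(y in ball x r) g y < +oo)%E.

(* Minimality (up to null sets) is among the weak upper gradients that are
   integrable on balls. Without integrability a least one need not exist: on
   the real line every positive multiple of a finite g with infinite integral
   on each nontrivial interval is an upper gradient of every finite u. For u
   in N11 this is the same as minimality among the integrable ones. *)
Definition minimal_weak_upper_gradient (u g : X -> \bar R) : Prop :=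
  [/\ weak_upper_gradient u g, integrable_on_balls g &
      forall h, weak_upper_gradient u h -> integrable_on_balls h ->
        {ae m, forall x, (g x <= h x)%E}].

Definition N11 (u : X -> \bar R) : Prop :=
  m.-integrable setT u /\
  exists2 g, upper_gradient u g & m.-integrable setT g.

Definition mean (f : X -> \bar R) (A : set X) : \bar R :=
  ((mu A)^-1 * \int[m]_(x in A) f x)%E.

Definition local_weak_poincare : Prop :=
  exists CP RP tau : R, [/\ 0 < CP, 0 < RP, 1 <= tau &
    forall (x : X) (r : R), 0 < r <= RP ->
      (0 < mu (ball x (tau * r)) < +oo)%E /\
      forall u : X -> R,
        m.-integrable (ball x (tau * r)) (EFin \o u) ->
        forall g, minimal_weak_upper_gradient (EFin \o u) g ->
          (mean (fun y => `|(u y)%:E - mean (EFin \o u) (ball x r)|)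
                (ball x r)
           <= (CP * r)%:E * mean g (ball x (tau * r)))%E].

Definition bounded_support (u : X -> \bar R) : Prop :=
  exists (x : X) (r : R), closure [set y | u y != 0%E] `<=` ball x r.

Definition S11 : Prop :=
  exists2 C : R, 0 < C &
    forall u, N11 u -> bounded_support u ->
      forall g, minimal_weak_upper_gradient u g ->
        (\int[m]_x `|u x| <= C%:E * \int[m]_x g x)%E.

End MetricMeasureSpace.

(* Main.v *)
(** If X is amenable, a finite subset F of a quasi-lattice with relatively small
    boundary yields the function u equal to 1 near F and decreasing linearly to
    0: its mass is at least a multiple of #F, while the set where 0 < u < 1,
    whose indicator is an upper gradient of u, is covered by balls around the
    boundary of F. This contradicts (S_{1,1}).

    Conversely, on a non-amenable quasi-lattice the isoperimetric inequality
    gives, by the coarea formula, a discrete Sobolev inequality. It is applied to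
    the averages of min(|u|, k) over small balls; averages at neighbouring
    lattice points are compared by chaining the local Poincare inequality along
    a quasiconvex curve, and k tends to infinity.

    Both (S_{1,1}) and the Poincare inequality speak about a function only
    through a minimal weak upper gradient, so its existence is needed in both
    directions: weak upper gradients that are integrable on balls form a lattice,
    and the limit of a decreasing minimising sequence is minimal. *)

(* Two obstacles shape the proof. Non-amenability gives isoperimetry at a scale r over which there
   is no control, while the Poincare inequality holds only for radii up to [RP]. Averages are
   therefore taken over balls of radius [RP / 2], and lattice points at distance less than 2r are
   linked by a chain of such balls; length and reach of the chain depend only on r, [RP] and the
   constant of quasiconvexity, so the balls involved have bounded overlap. The lattice must be fine
   enough for the small balls to cover X, which is a free choice because non-amenability speaks of
   every quasi-lattice. The second obstacle is the minimum of two weak upper gradients. Along one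
   curve it reduces to a statement on an interval: a function whose increments are bounded by the
   integrals of G1 and of G2 over every subinterval has them bounded by the integral of the minimum.
   This uses the gradient inequality on all subcurves, hence a description of exceptional families
   that passes to larger curves, and finite line integrals, which integrability on balls provides
   outside an exceptional family. *)
Require Import Defs.
From HB Require Import structures.
From mathcomp Require Import all_boot all_order all_algebra finmap.
From mathcomp Require Import all_classical all_reals all_analysis.
From mathcomp Require Import measurable_realfun lra ring.

Set Implicit Arguments.
Unset Strict Implicit.
Unset Printing Implicit Defensive.

Import Order.TTheory GRing.Theory Num.Theory.
Import numFieldNormedType.Exports.

Local Open Scope classical_set_scope.
Local Open Scope ring_scope.

(** * Length and arc length of curves *)

Section CurveLength.
Context {R : realType} {X : pmetricType R}.
Implicit Types (c : R -> X) (a b t : R).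

Fixpoint plen c a (s : seq R) : R :=
  if s is x :: s' then mdist (c a) (c x) + plen c x s' else 0.

Lemma polygonal_lengthE c a b s : polygonal_length c a b s = plen c a s.
Proof.
rewrite /polygonal_length; elim: s a => [|x s IH] a; first by rewrite big_nil.
by rewrite big_nat_recl//= -IH.
Qed.

Lemma plen_length_on c a b s :
  itv_partition a b s -> ((plen c a s)%:E <= length_on c a b)%E.
Proof.
by move=> ?; apply: ereal_sup_ubound; exists s => //; rewrite polygonal_lengthE.
Qed.

Lemma length_on_le c a b y :
  (forall s, itv_partition a b s -> ((plen c a s)%:E <= y)%E) ->
  (length_on c a b <= y)%E.
Proof.
move=> H; apply: ge_ereal_sup => _ [s ps <-].
by rewrite polygonal_lengthE; exact: H.
Qed.

Lemma length_on_xx c a : length_on c a a = 0%E.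
Proof.
apply/eqP; rewrite eq_le; apply/andP; split.
  by apply: length_on_le => s /itv_partitionxx ->.
by apply: (@plen_length_on c a a [::]); split.
Qed.

Lemma mdist_length_on c a b :
  a <= b -> ((mdist (c a) (c b))%:E <= length_on c a b)%E.
Proof.
rewrite le_eqVlt => /predU1P[->|ab]; first by rewrite mdistxx length_on_xx.
have := plen_length_on c (itv_partition1 ab).
by rewrite /= addr0.
Qed.

Lemma length_on_ge0 c a b : a <= b -> (0 <= length_on c a b)%E.
Proof. by move/(mdist_length_on c); apply: le_trans; rewrite lee_fin mdist_ge0. Qed.

Lemma length_on_cons c a x b : a <= x -> x <= b ->
  ((mdist (c a) (c x))%:E + length_on c x b <= length_on c a b)%E.
Proof.
rewrite le_eqVlt => /predU1P[->|ax] xb; first by rewrite mdistxx add0e.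
rewrite -leeBrDl//; apply: length_on_le => s [s1 s2].
rewrite leeBrDl// -EFinD.
by apply: (@plen_length_on c a b (x :: s)); split => //=; rewrite ax.
Qed.

(** Lengths may be infinite here. For the upper bound, a partition of [a, t] is refined at b inside
    the segment that jumps over b; for the lower bound, partitions of [a, b] are prepended one
    segment at a time. *)
Lemma length_onD c a b t : a <= b -> b <= t ->
  (length_on c a b + length_on c b t = length_on c a t)%E.
Proof.
move=> ab bt; apply/eqP; rewrite eq_le; apply/andP; split; last first.
  apply: length_on_le => s; elim: s a ab => [|x s IH] a ab.
    move=> /itv_partition_nil at_.
    by rewrite adde_ge0// length_on_ge0.
  move=> ps; have [ax _] : a < x /\ x <= t.
    split; first by case: ps => /= /andP[].
    exact: itv_partition_le (itv_partition_cons ps).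
  rewrite /= EFinD; have [xb|bx] := leP x b.
    apply: le_trans (leeD2l _ (IH _ xb (itv_partition_cons ps))) _.
    by rewrite addeA leeD2r// length_on_cons// ltW.
  apply: (@le_trans _ _ ((mdist (c a) (c b))%:E +
      (mdist (c b) (c x) + plen c x s)%:E)%E).
    by rewrite -!EFinD lee_fin addrA lerD2r metric_triangle.
  apply: leeD; first exact: mdist_length_on.
  apply: (@plen_length_on c b t (x :: s)).
  by case: ps => /= /andP[_ p1] p2; split => //=; rewrite bx.
have key s : itv_partition a b s ->
    ((plen c a s)%:E + length_on c b t <= length_on c a t)%E.
  elim: s a ab => [|x s IH] a ab.
    by move=> /itv_partition_nil ->; rewrite add0e.
  move=> ps; have [ax xb] : a < x /\ x <= b.
    split; first by case: ps => /= /andP[].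
    exact: itv_partition_le (itv_partition_cons ps).
  rewrite /= EFinD -addeA.
  apply: le_trans (leeD2l _ (IH _ xb (itv_partition_cons ps))) _.
  by apply: length_on_cons; [exact: ltW|exact: le_trans bt].
(* Taking the supremum in [key] means subtracting the length of the second piece, so the infinite
   case is separate. *)
have [fin|] := boolP (length_on c b t \is a fin_num).
  rewrite -leeBrDr//; apply: length_on_le => s ps.
  by rewrite leeBrDr//; exact: key.
rewrite ge0_fin_numE ?length_on_ge0// -leNgt leye_eq => /eqP E.
have [s ps] : exists s, itv_partition a b s.
  move: ab; rewrite le_eqVlt => /predU1P[->|/itv_partition1]; last by exists [:: b].
  by exists [::].
have := key _ ps; rewrite E addey// ?ltNyr// leye_eq => /eqP ->.
by rewrite leey.
Qed.

(** Here x is the penultimate point of a good partition, and all chords before it are replaced by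
    length. With its mirror image [length_on_first] it excludes jumps of the length function. *)
Lemma length_on_last c a b s0 : a < b -> (s0%:E < length_on c a b)%E ->
  exists x, [/\ a <= x, x < b &
    (s0%:E < length_on c a x + (mdist (c x) (c b))%:E)%E].
Proof.
move=> ab /ereal_sup_gt[_ [s ps <-]]; rewrite polygonal_lengthE => s0s.
suff [x [ax xb H]] : exists x, [/\ a <= x, x < b &
    ((plen c a s)%:E <= length_on c a x + (mdist (c x) (c b))%:E)%E].
  by exists x; split => //; exact: lt_le_trans H.
elim: s a ab ps {s0s} => [|x s IH] a ab ps.
  by move/itv_partition_nil: ps ab => ->; rewrite ltxx.
have [ax xb] : a < x /\ x <= b.
  split; first by case: ps => /= /andP[].
  exact: itv_partition_le (itv_partition_cons ps).
move: xb; rewrite le_eqVlt => /predU1P[xb|xb].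
  exists a; split => //; subst x; rewrite length_on_xx add0e.
  by have /itv_partitionxx -> := itv_partition_cons ps; rewrite /= addr0.
have [y [xy yb H]] := IH x xb (itv_partition_cons ps).
exists y; split => //; first exact: le_trans (ltW ax) xy.
rewrite /= EFinD; apply: le_trans (leeD2l _ H) _; rewrite addeA leeD2r//.
exact: length_on_cons (ltW ax) xy.
Qed.

Lemma length_on_first c a b s0 : a < b -> (s0%:E < length_on c a b)%E ->
  exists x, [/\ a < x, x <= b &
    (s0%:E < (mdist (c a) (c x))%:E + length_on c x b)%E].
Proof.
move=> ab /ereal_sup_gt[_ [[|x s] ps <-]]; rewrite polygonal_lengthE => s0s.
  by move/itv_partition_nil: ps ab => ->; rewrite ltxx.
have [ax xb] : a < x /\ x <= b.
  split; first by case: ps => /= /andP[].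
  exact: itv_partition_le (itv_partition_cons ps).
exists x; split => //; apply: lt_le_trans s0s _.
by rewrite /= EFinD leeD2l// plen_length_on//; exact: itv_partition_cons ps.
Qed.

End CurveLength.

(** * The length function of a curve and its arc length parametrization *)

Section ArcLength.
Context {R : realType} {X : pmetricType R}.
Implicit Type c : curve X.

Definition clen c (t : R) : R := fine (length_on c (curve_l c) t).

Lemma curve_continuousP c t0 e : curve_l c <= t0 <= curve_r c -> 0 < e ->
  exists2 d, 0 < d & forall t, curve_l c <= t <= curve_r c -> `|t - t0| < d ->
    mdist (c t0) (c t) < e.
Proof.
move=> t0P e0; have /subspace_continuousP/(_ t0) := @curve_continuous _ _ c.
rewrite /= in_itv/= => /(_ t0P) H.
have /nbhs_ballP[d /= d0 H2] : nbhs t0 (fun t =>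
    `[curve_l c, curve_r c]%classic t -> mdist (c t0) (c t) < e).
  by have := H _ (nbhsx_ballx (c t0) e e0); rewrite ballEmdist.
exists d => // t tP td; apply: H2; first by rewrite /ball/= distrC.
by rewrite /= in_itv.
Qed.

Lemma length_onE c s t : rectifiable c -> curve_l c <= s -> s <= t ->
  t <= curve_r c -> length_on c s t = (clen c t - clen c s)%:E.
Proof.
move=> rc ls st tr; have lt := le_trans ls st.
have fin u v : curve_l c <= u -> u <= v -> v <= curve_r c ->
    length_on c u v \is a fin_num.
  move=> lu uv vr; rewrite ge0_fin_numE ?length_on_ge0//; apply: le_lt_trans rc.
  rewrite /curve_length -(length_onD c lu (le_trans uv vr)) -(length_onD c uv vr).
  apply: (@le_trans _ _ (length_on c u v + length_on c v (curve_r c))%E).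
    by rewrite leeDl// length_on_ge0.
  by rewrite leeDr// length_on_ge0.
have := length_onD c ls st.
rewrite -(fineK (fin _ _ _ ls (le_trans st tr)))// -(fineK (fin _ _ ls st tr)).
rewrite -(fineK (fin _ _ _ lt tr))// => /eqP; rewrite -EFinD eqe => /eqP E.
by congr EFin; rewrite /clen -E addrAC subrr add0r.
Qed.

Lemma clen_l c : clen c (curve_l c) = 0.
Proof. by rewrite /clen length_on_xx. Qed.

Lemma mdist_clen c s t : rectifiable c -> curve_l c <= s -> s <= t ->
  t <= curve_r c -> mdist (c s) (c t) <= clen c t - clen c s.
Proof.
move=> rc ls st tr; rewrite -lee_fin -length_onE//; exact: mdist_length_on.
Qed.

Lemma clen_homo c s t : rectifiable c -> curve_l c <= s -> s <= t ->
  t <= curve_r c -> clen c s <= clen c t.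
Proof.
by move=> *; rewrite -subr_ge0; apply: le_trans (mdist_ge0 _ _) (mdist_clen _ _ _ _).
Qed.

Lemma curve_lengthE c : rectifiable c -> curve_length c = (clen c (curve_r c))%:E.
Proof.
by move=> rc; rewrite /curve_length length_onE// ?curve_le// clen_l subr0.
Qed.

(* The largest parameter with a given length is the one chosen by
   arc_length_param. *)
Lemma clen_surj c s : rectifiable c -> 0 <= s <= clen c (curve_r c) ->
  exists2 t0, curve_l c <= t0 <= curve_r c & clen c t0 = s /\
    forall t, curve_l c <= t <= curve_r c -> clen c t = s -> t <= t0.
Proof.
move=> rc /andP[s0 sr]; have lr := curve_le c.
pose S := [set t | curve_l c <= t <= curve_r c /\ clen c t <= s].
have Sl : S (curve_l c) by split; rewrite ?lexx// clen_l.
have ubS : ubound S (curve_r c) by move=> t [/andP[]].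
have hS : has_sup S by split; [exists (curve_l c)|exists (curve_r c)].
pose t0 := sup S.
have lt0 : curve_l c <= t0 by exact: ub_le_sup (proj2 hS) _ Sl.
have t0r : t0 <= curve_r c by apply: ge_sup => //; exists (curve_l c).
have t0P : curve_l c <= t0 <= curve_r c by rewrite lt0 t0r.
exists t0 => //; split; last first.
  by move=> t tP Vt; apply: ub_le_sup (proj2 hS) _ _; split => //; rewrite Vt.
(* Suppose the length jumps over s at t0. A partition that detects the jump has a chord ending
   (starting) at t0. Moving this endpoint to a nearby t changes the chord by less than the excess
   [e0], which contradicts t in [S] before t0, or puts a t after t0 into [S]. *)
apply/eqP; rewrite eq_le !leNgt; apply/andP; split; apply/negP => H.
- have {}lt0 : curve_l c < t0.
    rewrite lt_neqAle lt0 andbT; apply/eqP => E.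
    by move: H; rewrite -E clen_l ltNge s0.
  have := @length_on_last _ _ c (curve_l c) t0 s lt0.
  rewrite length_onE ?lexx// ?ltW// clen_l subr0 lte_fin => /(_ H)[x [lx xt0]].
  rewrite length_onE ?lexx// ?clen_l ?subr0; last exact: le_trans (ltW xt0) t0r.
  rewrite -EFinD lte_fin -subr_gt0 => e0.
  have [d d0 Hd] := curve_continuousP t0P e0.
  have m0 : 0 < Num.min d (t0 - x) by rewrite lt_min d0 subr_gt0.
  have [t [tlr Vt] tm] := sup_adherent m0 hS; rewrite -/t0 in tm.
  have [td tx] : t0 - d < t /\ x < t.
    have : Num.min d (t0 - x) <= d by rewrite ge_min lexx.
    have : Num.min d (t0 - x) <= t0 - x by rewrite ge_min lexx orbT.
    by move=> h1 h2; split; lra.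
  have tt0 : t <= t0 by apply: ub_le_sup (proj2 hS) _ _; split.
  have dt : `|t - t0| < d by rewrite ler0_norm ?subr_le0// opprB; lra.
  have h1 := Hd t tlr dt.
  have h2 : clen c x + mdist (c x) (c t) <= clen c t.
    rewrite -lerBrDl; apply: mdist_clen => //; [exact: ltW|by case/andP: tlr].
  have h3 := metric_triangle (c x) (c t) (c t0).
  rewrite (metric_sym (c t0)) in h1.
  by lra.
- have t0lr : t0 < curve_r c.
    rewrite lt_neqAle t0r andbT; apply/eqP => E.
    by move: H; rewrite E ltNge sr.
  have := @length_on_first _ _ c t0 (curve_r c) (clen c (curve_r c) - s) t0lr.
  rewrite length_onE ?lexx// lte_fin ltrD2l ltrN2 => /(_ H)[x [t0x xr]].
  rewrite length_onE ?lexx//; last exact: le_trans (ltW t0x).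
  rewrite -EFinD lte_fin => e0.
  have {}e0 : 0 < mdist (c t0) (c x) + s - clen c x by lra.
  have [d d0 Hd] := curve_continuousP t0P e0.
  pose t := Num.min (t0 + d / 2) x.
  have tx : t <= x by rewrite ge_min lexx orbT.
  have tt0 : t0 < t by rewrite lt_min t0x andbT; lra.
  have td : t <= t0 + d / 2 by rewrite ge_min lexx.
  have tlr : curve_l c <= t <= curve_r c.
    by apply/andP; split; lra.
  have dt : `|t - t0| < d by rewrite gtr0_norm ?subr_gt0//; lra.
  have h1 := Hd t tlr dt.
  have h2 : mdist (c t) (c x) <= clen c x - clen c t.
    by apply: mdist_clen => //; lra.
  have h3 := metric_triangle (c t0) (c t) (c x).
  have : S t by split => //; lra.
  by move/(ub_le_sup (proj2 hS)); rewrite -/t0 leNgt tt0.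
Qed.

(** The parameter chosen by [arc_length_param] may be larger than t, but no length is spent between
    the two, so the curve takes the same value at both. *)
Lemma arc_clen c t : rectifiable c -> curve_l c <= t <= curve_r c ->
  arc_length_param c (clen c t) = c t.
Proof.
move=> rc /andP[lt tr].
have [|t0 t0P [Vt0 Ht0]] := @clen_surj c (clen c t) rc.
  by rewrite -{1}(clen_l c) !clen_homo// lexx.
have /andP[lt0 t0r] := t0P.
have -> : arc_length_param c (clen c t) = c t0.
  rewrite /arc_length_param; congr (c _).
  have Et u : curve_l c <= u <= curve_r c ->
      length_on c (curve_l c) u = (clen c u)%:E.
    by move=> /andP[lu ur]; rewrite length_onE// clen_l subr0.
  apply/eqP; rewrite eq_le; apply/andP; split.
    apply: ge_sup => [|u [uP]]; first by exists t0; split => //; rewrite Et// Vt0.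
    by rewrite Et// => -[]; exact: Ht0.
  apply: ub_le_sup; last by split => //; rewrite Et// Vt0.
  by exists (curve_r c) => u [/andP[]].
have tt0 : t <= t0 by apply: Ht0; rewrite ?lt.
apply/esym/mdist_positivity/eqP; rewrite eq_le mdist_ge0 andbT.
by apply: le_trans (mdist_clen rc lt tt0 t0r) _; rewrite Vt0 subrr.
Qed.

Lemma mdist_arc c s1 s2 : rectifiable c -> 0 <= s1 -> s1 <= s2 ->
  s2 <= clen c (curve_r c) ->
  mdist (arc_length_param c s1) (arc_length_param c s2) <= s2 - s1.
Proof.
move=> rc s10 s12 s2r.
have [|t1 t1P [V1 _]] := @clen_surj c s1 rc; first by rewrite s10 (le_trans s12).
have [|t2 t2P [V2 _]] := @clen_surj c s2 rc; first by rewrite s2r (le_trans s10).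
have /andP[lt1 t1r] := t1P; have /andP[lt2 t2r] := t2P.
rewrite -V1 -V2 !arc_clen//; have [t12|t21] := leP t1 t2; first exact: mdist_clen.
have E : s1 = s2.
  apply/eqP; rewrite eq_le s12 -V1 -V2 clen_homo//; exact: ltW.
have := mdist_clen rc lt2 (ltW t21) t1r.
by rewrite V1 V2 E subrr metric_sym.
Qed.

End ArcLength.

Section ClampLipschitz.
Context {R : realType}.
Implicit Types a x y : R.

Lemma ler_dist_max a x y : `|Num.max a x - Num.max a y| <= `|x - y|.
Proof.
have h1 := ler_norm (x - y); have := ler_norm (- (x - y)).
rewrite normrN => h2; set D := `|x - y| in h1 h2 *.
case: (leP a x) => ?; case: (leP a y) => ?; rewrite ler_norml;
  by apply/andP; split; lra.
Qed.

Lemma ler_dist_min a x y : `|Num.min a x - Num.min a y| <= `|x - y|.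
Proof.
have h1 := ler_norm (x - y); have := ler_norm (- (x - y)).
rewrite normrN => h2; set D := `|x - y| in h1 h2 *.
case: (leP a x) => ?; case: (leP a y) => ?; rewrite ler_norml;
  by apply/andP; split; lra.
Qed.

End ClampLipschitz.

(** * Line integrals in arc length *)

Section LineIntegral.
Context {R : realType} {X : pmetricType R}.
Implicit Type c : curve X.
Local Notation leb := (@lebesgue_measure R).
Local Notation borelX := (g_sigma_algebraType (@open X)).

(** The pushforward of Lebesgue measure under a translation agrees with it on half-open intervals,
    hence everywhere. *)
Lemma ge0_integral_shift (f : R -> \bar R) (a b : R) :
  measurable_fun `[a, b] f -> (forall x, `[a, b]%classic x -> (0 <= f x)%E) ->
  (\int[leb]_(s in `[0%R, (b - a)%R]) f (a + s)%R = \int[leb]_(s in `[a, b]) f s)%E.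
Proof.
move=> mf f0; pose phi := (fun s : R => a + s) : measurableTypeR R -> measurableTypeR R.
have mphi : measurable_fun setT phi by exact: measurable_funD.
have -> : `[0%R, (b - a)%R]%classic = phi @^-1` `[a, b].
  by apply/seteqP; split => s /=; rewrite !in_itv/= /phi lerDl lerBrDl.
have := @ge0_integral_pushforward _ _ _ _ _ _ mphi leb `[a, b] f.
move=> <- //; last by move=> y; rewrite inE; exact: f0.
apply: eq_measure_integral => /= A mA _.
apply/esym/lebesgue_measure_unique => //= _ [[x y]] _ <-.
have -> : pushforward leb phi `]x, y]%classic = leb `](x - a), (y - a)]%classic.
  rewrite /pushforward; congr (leb _).
  by apply/seteqP; split => s /=; rewrite !in_itv/= /phi ltrBlDl lerBrDl.
rewrite !lebesgue_measure_itv/= !lte_fin ltrD2r.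
by rewrite -!EFinB opprB addrA subrK.
Qed.

Lemma continuous_borel_measurable (f : R -> X) :
  (forall x e, 0 < e -> exists2 d, 0 < d &
     forall y, `|y - x| < d -> mdist (f x) (f y) < e) ->
  measurable_fun setT (f : measurableTypeR R -> borelX).
Proof.
move=> fc; apply: (@measurability _ _ _ borelX _ _ (@open X)) => //.
move=> _ [A oA <-]; rewrite setTI; apply: open_measurable.
rewrite openE => x /= Ax.
have := open_nbhs_nbhs (conj oA Ax).
move=> /nbhs_ballP[e /= e0 He].
have [d d0 Hd] := fc x e e0.
apply/nbhs_ballP; exists d => //= y xy.
apply: He; rewrite ballEmdist; apply: Hd.
by move: xy; rewrite /ball/= distrC.
Qed.

(** Outside [0, L] the parametrization has no meaning. Clamping makes it 1-Lipschitz on the whole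
    line, so measurability follows from continuity. *)
Lemma arc_continuous_clamp c : rectifiable c ->
  measurable_fun setT ((fun s : R => arc_length_param c
     (Num.max 0 (Num.min s (clen c (curve_r c))))) : measurableTypeR R -> borelX).
Proof.
move=> rc; apply: continuous_borel_measurable => x e e0; exists e => // y xy.
set L := clen _ _; have L0 : 0 <= L.
  by rewrite /L -(clen_l c) clen_homo// ?lexx// curve_le.
set p := Num.max _ _; set q := Num.max _ _.
have [p0 q0] : 0 <= p /\ 0 <= q by rewrite !le_max !lexx.
have [pL qL] : p <= L /\ q <= L by rewrite !ge_max !ge_min !lexx !L0 !orbT.
have pq : `|q - p| <= `|y - x|.
  apply: le_trans (ler_dist_max _ _ _) _.
  by rewrite ![Num.min _ L]minC; exact: ler_dist_min.
apply: le_lt_trans xy; apply: le_trans pq.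
have [pq|/ltW qp] := leP p q.
  by rewrite ger0_norm ?subr_ge0//; exact: mdist_arc.
by rewrite ler0_norm ?subr_le0// opprB metric_sym; exact: mdist_arc.
Qed.

Lemma measurable_fun_arc c g : rectifiable c -> borel_fun g ->
  measurable_fun `[0, clen c (curve_r c)] (g \o arc_length_param c).
Proof.
move=> rc mg; apply: (@eq_measurable_fun _ _ _ _ _
  (g \o (fun s : R => arc_length_param c
     (Num.max 0 (Num.min s (clen c (curve_r c))))))).
  move=> s; rewrite inE/= in_itv/= => /andP[s0 sL].
  by rewrite (min_idPl sL) (max_idPr s0).
apply: measurable_funTS.
exact: (measurableT_comp (T2 := borelX) mg (arc_continuous_clamp rc)).
Qed.

Lemma line_integralE c g : rectifiable c ->
  line_integral c g =
  (\int[leb]_(s in `[0%R, clen c (curve_r c)]) g (arc_length_param c s))%E.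
Proof. by move=> rc; rewrite /line_integral curve_lengthE. Qed.

(** The arc length on the restriction is that of c shifted by [clen c t1], which turns its line
    integral into an integral over a subinterval of the arc length interval of c. *)
Lemma subcurve_exists c t1 t2 : rectifiable c -> curve_l c <= t1 -> t1 <= t2 ->
  t2 <= curve_r c ->
  exists c' : curve X, [/\ rectifiable c', curve_l c' = t1, curve_r c' = t2,
    curve_fun c' = curve_fun c &
    [/\ curve_length c' = (clen c t2 - clen c t1)%:E &
    forall g, borel_fun g -> (forall x, (0 <= g x)%E) ->
      line_integral c' g = (\int[leb]_(s in `[clen c t1, clen c t2])
         g (arc_length_param c s))%E]].
Proof.
move=> rc lt1 t12 t2r.
have cc : {within `[t1, t2], continuous c}.
  apply: continuous_subspaceW (@curve_continuous _ _ c) => t /=.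
  by rewrite !in_itv/= => /andP[h1 h2]; rewrite (le_trans lt1)// (le_trans h2).
have lenE : curve_length (Curve t12 cc) = (clen c t2 - clen c t1)%:E.
  by rewrite /curve_length/= length_onE.
have rc' : rectifiable (Curve t12 cc) by rewrite /rectifiable lenE ltry.
exists (Curve t12 cc); split; [exact: rc'|exact: erefl..|].
split=> [|g mg g0]; first exact: lenE.
have clenE t : t1 <= t <= t2 -> clen (Curve t12 cc) t = clen c t - clen c t1.
  by move=> /andP[h1 h2]; rewrite {1}/clen/= length_onE// (le_trans h2).
have c2E : clen (Curve t12 cc) t2 = clen c t2 - clen c t1 by rewrite clenE ?t12/=.
rewrite (line_integralE g rc') [X in `[0, X]%classic]c2E.
have t2P : clen c t2 <= clen c (curve_r c).
  by rewrite clen_homo ?lexx// (le_trans lt1).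
have t1P : 0 <= clen c t1 by rewrite -(clen_l c) clen_homo ?lexx// (le_trans t12).
rewrite -(@ge0_integral_shift (g \o arc_length_param c)) //;
  last by move=> s _; exact: g0.
  2: { apply: measurable_funS (measurable_fun_arc rc mg) => // s /=.
  rewrite !in_itv/= => /andP[h1 h2]; rewrite (le_trans t1P)//.
  exact: le_trans t2P. }
apply: eq_integral => s; rewrite inE => sI.
have {sI} sP : 0 <= s <= clen c t2 - clen c t1 by move: sI; rewrite /= in_itv.
transitivity (g (arc_length_param c (clen c t1 + s))) => //; congr g.
have [|t tP [Vt _]] := @clen_surj _ _ (Curve t12 cc) s rc'.
  by rewrite [X in _ <= _ <= X]c2E.
rewrite -Vt arc_clen// clenE// addrCA subrr addr0 arc_clen//.
by case/andP: tP => /= h1 h2; rewrite (le_trans lt1)// (le_trans h2).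
Qed.

Lemma arc_ends c : rectifiable c ->
  arc_length_param c 0 = c (curve_l c) /\
  arc_length_param c (clen c (curve_r c)) = c (curve_r c).
Proof.
by move=> rc; rewrite -{1}(clen_l c) !arc_clen// !lexx ?curve_le.
Qed.

Lemma clen_ge0 c : rectifiable c -> 0 <= clen c (curve_r c).
Proof. by move=> rc; rewrite -(clen_l c) clen_homo ?lexx// curve_le. Qed.

Lemma line_integral_ge0 c g : (forall x, (0 <= g x)%E) ->
  (0 <= line_integral c g)%E.
Proof. by move=> g0; apply: integral_ge0. Qed.

Lemma line_integral_le c g h : rectifiable c -> borel_fun g -> borel_fun h ->
  (forall x, (0 <= g x)%E) ->
  (forall s, 0 <= s <= clen c (curve_r c) ->
     (g (arc_length_param c s) <= h (arc_length_param c s))%E) ->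
  (line_integral c g <= line_integral c h)%E.
Proof.
move=> rc mg mh g0 gh; rewrite !line_integralE//; apply: ge0_le_integral => //.
  exact: measurable_fun_arc.
  exact: measurable_fun_arc.
Qed.

Lemma line_integralZ c g k : rectifiable c -> borel_fun g ->
  (forall x, (0 <= g x)%E) -> 0 <= k ->
  line_integral c (fun x => k%:E * g x)%E = (k%:E * line_integral c g)%E.
Proof.
move=> rc mg g0 k0; rewrite !line_integralE// ge0_integralZl_EFin//.
exact: measurable_fun_arc.
Qed.

Lemma line_integral_series c (g : nat -> X -> \bar R) : rectifiable c ->
  (forall n, borel_fun (g n)) -> (forall n x, (0 <= g n x)%E) ->
  line_integral c (fun x => \sum_(n <oo) g n x)%E =
  (\sum_(n <oo) line_integral c (g n))%E.
Proof.
move=> rc mg g0; rewrite line_integralE// integral_nneseries//; last first.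
  by move=> n; exact: measurable_fun_arc.
Qed.

End LineIntegral.

(** * Exceptional families of curves *)

Section Modulus.
Context {R : realType} {X : pmetricType R}.
Variable mu : {outer_measure set X -> \bar R}.
Hypothesis borel_cara : forall A : set X, borel_set A -> mu.-caratheodory A.
Implicit Type c : curve X.
Local Notation m := (cara_measure mu).
Local Notation borelX := (g_sigma_algebraType (@open X)).

Lemma borel_measurable (A : set X) : borel_set A ->
  measurable (A : set (caratheodory_type mu)).
Proof. exact: borel_cara. Qed.

Lemma borel_fun_measurable g : borel_fun g ->
  measurable_fun setT (g : caratheodory_type mu -> \bar R).
Proof.
move=> mg _ B mB; apply: borel_measurable; exact: mg.
Qed.

Definition test_density (rho : X -> \bar R) :=
  [/\ borel_fun rho, forall x, (0 <= rho x)%E & (\int[m]_x rho x < +oo)%E].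

Lemma test_density_series (rho : nat -> X -> \bar R) :
  (forall n, borel_fun (rho n)) -> (forall n x, (0 <= rho n x)%E) ->
  (forall n, (\int[m]_x rho n x <= (1 / (2 ^ n.+1)%:R)%:E)%E) ->
  test_density (fun x => \sum_(n <oo) rho n x)%E.
Proof.
move=> mrho rho0 irho; split.
- by apply: ge0_emeasurable_sum => // n _; exact: mrho.
- by move=> x; apply: nneseries_ge0.
- rewrite integral_nneseries//; last by move=> n; exact: borel_fun_measurable.
  apply: (@le_lt_trans _ _ (1%R)%:E); last exact: ltry.
  apply: le_trans (epsilon_trick0 xpredT ler01).
  apply: lee_nneseries => // n _ _; exact: integral_ge0.
Qed.

(** Countably many exceptional families are exceptional together: sigma is a weighted sum of their
    densities. *)
Lemma test_density_seq (rho : nat -> X -> \bar R) :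
  (forall n, test_density (rho n)) ->
  exists2 sigma, test_density sigma &
    forall c, rectifiable c -> (line_integral c sigma < +oo)%E ->
    forall n, (line_integral c (rho n) < +oo)%E.
Proof.
move=> H; pose I n := fine (\int[m]_x rho n x).
have IE n : (\int[m]_x rho n x = (I n)%:E)%E.
  by have [_ r0 fi] := H n; rewrite fineK// ge0_fin_numE// integral_ge0.
have I0 n : 0 <= I n.
  by rewrite -lee_fin -IE; apply: integral_ge0 => x _; have [_] := H n.
(* The weight makes the n-th term integrate to at most [1 / 2 ^ n.+1]; the added 1 avoids a division
   by zero. *)
pose a n := (1 / (2 ^ n.+1)%:R) / (1 + I n).
have a0 n : 0 < a n by rewrite !divr_gt0// ?ltr0n ?expn_gt0// ltr_pwDl.
exists (fun x => \sum_(n <oo) (a n)%:E * rho n x)%E.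
  apply: test_density_series => [n|n x|n].
  - by apply: measurable_funeM; have [] := H n.
  - by apply: mule_ge0; [rewrite lee_fin ltW|have [] := H n].
  - have [mr r0 fi] := H n.
    rewrite ge0_integralZl_EFin// ?(ltW (a0 n))//; last exact: borel_fun_measurable.
    rewrite IE -EFinM lee_fin /a; set w := 1 / _.
    have w0 : 0 <= w by rewrite divr_ge0.
    rewrite -mulrA ler_piMr//.
    by rewrite mulrC ler_pdivrMr ?ltr_pwDl// mul1r lerDr.
move=> c rc; rewrite line_integral_series//; last 2 first.
- by move=> n; apply: measurable_funeM; have [] := H n.
- by move=> n x; apply: mule_ge0; [rewrite lee_fin ltW|have [] := H n].
move=> fin n; have [mr r0 fi] := H n.
have : ((a n)%:E * line_integral c (rho n) < +oo)%E.
  apply: le_lt_trans fin; rewrite -line_integralZ// ?(ltW (a0 n))//.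
  rewrite (@nneseriesD1 _ _ n)//; last first.
    move=> k _; apply: line_integral_ge0 => x; apply: mule_ge0.
      by rewrite lee_fin ltW.
    by have [] := H k.
  rewrite leeDl//; apply: nneseries_ge0 => k _ _; apply: line_integral_ge0 => x.
  by apply: mule_ge0; [rewrite lee_fin ltW|have [] := H k].
have := line_integral_ge0 c r0; case: (line_integral c (rho n)) => // [r _ _|].
  exact: ltry.
by rewrite gt0_muley ?lte_fin// ltxx.
Qed.

(* Exceptional families are described by one density with infinite line
   integral, a property that passes to all curves containing an exceptional
   subcurve; this gives weak upper gradients along subcurves. *)
Lemma modulus1_eq0 (S : set (curve X)) : modulus1 mu S = 0%E <->
  exists2 rho, test_density rho &
    forall c, S c -> rectifiable c -> line_integral c rho = +oo%E.
Proof.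
split=> [S0|[rho [mr r0 fi] Hrho]].
  (* Admissible densities of geometrically small mass are summed: the total mass is at most 1, but
     along a curve of S each term contributes at least 1. *)
  have ex n : exists rho, [/\ borel_fun rho, forall x, (0 <= rho x)%E,
      (\int[m]_x rho x <= (1 / (2 ^ n.+1)%:R)%:E)%E &
      forall c, S c -> rectifiable c -> (1 <= line_integral c rho)%E].
    have := @ereal_inf_lt _
      [set (\int[m]_x rho x)%E | rho in modulus_admissible S]
      (1 / (2 ^ n.+1)%:R)%:E.
    rewrite [ereal_inf _]S0 lte_fin => /(_ _)[|_ [rho [h1 h2 h3] <-] h4].
      by rewrite divr_gt0// ltr0n expn_gt0.
    by exists rho; split => //; exact: ltW.
  have [rho Hrho] := choice ex.
  exists (fun x => \sum_(n <oo) rho n x)%E.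
    by apply: test_density_series => [n|n x|n]; have [] := Hrho n.
  move=> c Sc rc; rewrite line_integral_series//; last 2 first.
  - by move=> n; have [] := Hrho n.
  - by move=> n x; have [] := Hrho n.
  apply/eqyP => r r_gt0.
  apply: le_trans (@nneseries_lim_ge R (fun n => line_integral c (rho n))
    xpredT 0 (Num.truncn r).+1 _); last first.
    by move=> n _ _; apply: line_integral_ge0; have [] := Hrho n.
  apply: (@le_trans _ _ (\sum_(0 <= i < (Num.truncn r).+1) 1)%E); last first.
    by apply: lee_sum => i _; have [_ _ _] := Hrho i; exact.
  rewrite big_mkord sumEFin lee_fin sumr_const card_ord.
  by rewrite ltW// truncnS_gt.
apply/eqP; rewrite eq_le; apply/andP; split; last first.
  by apply: le_ereal_inf_tmp => _ [g [_ g0 _] <-]; exact: integral_ge0.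
apply/lee_addgt0Pr => e e0; rewrite add0e.
have [I IE] : exists I, (\int[m]_x rho x = I%:E)%E.
  by exists (fine (\int[m]_x rho x)); rewrite fineK// ge0_fin_numE// integral_ge0.
have I0 : 0 <= I by rewrite -lee_fin -IE integral_ge0.
(* Scaling keeps the line integrals over S infinite, so [k * rho] is admissible, and its mass is at
   most e. *)
pose k := e / (1 + I).
have k0 : 0 < k by rewrite divr_gt0// ltr_pwDl.
apply: (@le_trans _ _ (\int[m]_x (k%:E * rho x))%E).
  apply: ereal_inf_lbound; exists (fun x => k%:E * rho x)%E => //; split.
  - exact: measurable_funeM.
  - by move=> x; rewrite mule_ge0// lee_fin ltW.
  - move=> c Sc rc; rewrite line_integralZ// ?(ltW k0)// Hrho//.
    by rewrite gt0_muley ?lte_fin// leey.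
rewrite ge0_integralZl_EFin// ?(ltW k0)//; last exact: borel_fun_measurable.
rewrite IE -EFinM lee_fin /k mulrAC ler_pdivrMr ?ltr_pwDl//.
by rewrite ler_wpM2l ?(ltW e0)// lerDr.
Qed.

Lemma weak_upper_gradientP (u g : X -> \bar R) : weak_upper_gradient mu u g <->
  [/\ borel_fun g, forall x, (0 <= g x)%E &
    exists2 rho, test_density rho & forall c, rectifiable c ->
      (line_integral c rho < +oo)%E -> gradient_ineq u g c].
Proof.
split=> -[mg g0 [S]].
  move=> /modulus1_eq0[rho trho Hrho] HS; split => //; exists rho => // c rc fin.
  by apply: HS => // Sc; move: fin; rewrite Hrho// ltxx.
(* In this direction [S] is the density, not a family of curves. *)
move=> trho HS; split => //.
exists [set c | line_integral c S = +oo%E].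
  by apply/modulus1_eq0; exists S.
move=> c rc /= H; apply: HS => //; rewrite ltey; exact/eqP.
Qed.

End Modulus.

(** * Minimal weak upper gradients *)

Section AbsoluteContinuity.
Context d (T : measurableType d) {R : realType} (mu : {measure set T -> \bar R}).
Local Open Scope ereal_scope.

(** G may take the value +oo, but by integrability only on a null set; the claim is transferred from
    its finite part [f]. *)
Lemma ge0_integral_abs_cont (D : set T) (G : T -> \bar R) (e : R) :
  measurable D -> measurable_fun D G -> (forall x, D x -> 0 <= G x) ->
  \int[mu]_(x in D) G x < +oo -> (0 < e)%R ->
  exists2 del : R, (0 < del)%R & forall A, measurable A -> A `<=` D ->
    mu A < del%:E -> \int[mu]_(x in A) G x < e%:E.
Proof.
move=> mD mG G0 fG e0.
have intG : mu.-integrable D G.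
  apply/integrableP; split => //; rewrite (eq_integral G)// => x.
  by rewrite inE => Dx; rewrite gee0_abs// G0.
have intGD : mu.-integrable setT (G \_ D) by apply/(integrable_mkcond G mD).
have GD0 x : 0 <= (G \_ D) x by rewrite patchE; case: ifPn => //; rewrite inE => /G0.
pose f := fine \o (G \_ D).
have mf : measurable_fun setT (EFin \o f).
  apply/measurable_EFinP; apply: (measurableT_comp (f := fine)) => //.
  exact: (measurable_int mu intGD).
have aef : ae_eq mu setT (G \_ D) (EFin \o f).
  have := integrable_ae measurableT intGD.
  by apply: filterS => x /(_ I) fx _; rewrite /f/= fineK.
have intf : mu.-integrable setT (EFin \o f).
  apply/integrableP; split => //.
  rewrite -(@ae_eq_integral _ _ _ mu _ _ (fun x => `|(G \_ D) x|)) //.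
  - by case/integrableP: intGD.
  - by apply: measurableT_comp => //; exact: (measurable_int mu intGD).
  - exact: measurableT_comp.
  - by move: aef; apply: filterS => x H Tx; rewrite H.
have [del [del0 H]] := integral_normr_continuous intf e0.
exists del => // A mA AD muA; have := H A mA muA.
rewrite -lte_fin; apply: le_lt_trans.
rewrite /Rintegral fineK; last first.
  apply: integrable_fin_num => //; apply: integrableS measurableT mA _ _ => //.
  exact: integrable_abse intf.
rewrite (@ae_eq_integral _ _ _ mu A (EFin \o (fun x => `|f x|%R)) G) //.
- exact: measurable_funS mG.
- apply/measurable_EFinP; apply: measurableT_comp => //.
  by apply: measurable_funTS; exact/measurable_EFinP.
- move: aef; apply: filterS => x /(_ I) H2 Ax /=.
  have := H2; rewrite patchE mem_set; last exact: AD.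
  rewrite [RHS]/= => {}H2; rewrite H2 ger0_norm//.
  by rewrite -lee_fin -H2 G0//; exact: AD.
Qed.

End AbsoluteContinuity.

(** * Increments of a function on an interval bounded by integrals *)

Section OneDimensional.
Context {R : realType}.
Local Notation leb := (@lebesgue_measure R).

(* Real induction. *)
Lemma itv_chain (L : R) (P : R -> R -> Prop) : 0 <= L ->
  (forall s, 0 <= s <= L -> P s s) ->
  (forall s t w, 0 <= s -> s <= t -> t <= w -> w <= L -> P s t -> P t w -> P s w) ->
  (forall x, 0 <= x <= L -> exists2 d, 0 < d & forall s t, 0 <= s -> s <= t ->
     t <= L -> `|s - x| < d -> `|t - x| < d -> P s t) ->
  P 0 L.
Proof.
move=> L0 P1 PD Ploc.
pose S := [set t | 0 <= t <= L /\ P 0 t].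
have S0 : S 0 by split; rewrite ?lexx//; apply: P1; rewrite lexx.
have hS : has_sup S by split; [exists 0|exists L => t [/andP[]]].
set t0 := sup S.
have t00 : 0 <= t0 by exact: ub_le_sup (proj2 hS) _ S0.
have t0L : t0 <= L by apply: ge_sup; [exists 0|move=> t [/andP[]]].
have [|d d0 Hd] := Ploc t0; first by rewrite t00.
have [t [/andP[ht0 htL] Pt] tt] := sup_adherent d0 hS; rewrite -/t0 in tt.
have tt0 : t <= t0 by apply: ub_le_sup (proj2 hS) _ _; split => //; rewrite ht0.
(* Unless t0 = L, this point lies beyond t0, and it still belongs to the neighbourhood of [Hd]. *)
pose w := Num.min L (t0 + d / 2).
have t0w : t0 <= w by rewrite le_min t0L; lra.
have wL : w <= L by rewrite ge_min lexx.
have wd : w <= t0 + d / 2 by rewrite ge_min lexx orbT.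
have Pw : P 0 w.
  apply: (PD _ t) => //; first exact: le_trans t0w.
  apply: Hd => //; first exact: le_trans t0w.
    by rewrite ler0_norm ?subr_le0// opprB; lra.
  by rewrite ger0_norm ?subr_ge0//; lra.
have : w <= t0.
  by apply: ub_le_sup (proj2 hS) _ _; split => //; rewrite wL (le_trans t00).
rewrite /w ge_min => /orP[Lt0|]; last by lra.
by have <- : w = L by apply/eqP; rewrite eq_le wL /= (le_trans Lt0).
Qed.

Lemma ge0_integral_itv_cat (f : R -> \bar R) (s t w : R) : s <= t -> t <= w ->
  measurable_fun `[s, w] f -> (forall x, `[s, w]%classic x -> (0 <= f x)%E) ->
  (\int[leb]_(x in `[s, t]) f x + \int[leb]_(x in `[t, w]) f x =
   \int[leb]_(x in `[s, w]) f x)%E.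
Proof.
move=> st tw mf f0.
rewrite -(@integral_itv_bndo_bndc _ (BLeft s) t); last first.
  apply: measurable_funS mf => // x /=; rewrite !in_itv/= => /andP[-> /ltW xt].
  exact: le_trans tw.
rewrite (@itv_bndbnd_setU _ _ (BLeft s) (BLeft t) (BRight w)) ?bnd_simp//.
rewrite ge0_integral_setU//.
- by rewrite -itv_bndbnd_setU ?bnd_simp.
- by rewrite -itv_bndbnd_setU ?bnd_simp.
- apply/disj_setPS => x [] /=; rewrite !in_itv/= => /andP[_ xt] /andP[tx _].
  by move: xt; rewrite ltNge tx.
Qed.

Lemma abse_sub_triangle (x y z : \bar R) : y \is a fin_num ->
  (`|x - z| <= `|x - y| + `|y - z|)%E.
Proof.
case: y => [y| |] // _; case: x => [x| |]; case: z => [z| |] //=;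
  rewrite ?leey// ?addey// ?addye//.
rewrite -EFinD lee_fin; apply: le_trans (ler_normD _ _).
by rewrite addrA subrK.
Qed.

Lemma abse_subC (x y : \bar R) : (`|x - y| = `|y - x|)%E.
Proof. by case: x y => [x| |] [y| |] //=; rewrite distrC. Qed.

(* Exhaust {G1 <= G2} and {G2 < G1} by disjoint compacts: a short interval meets
   at most one of them, so one of the two bounds is locally the right one. *)
Lemma abse_le_integral_mine (L : R) (H G1 G2 : R -> \bar R) : 0 < L ->
  measurable_fun `[0, L] G1 -> measurable_fun `[0, L] G2 ->
  (forall s, (0 <= G1 s)%E) -> (forall s, (0 <= G2 s)%E) ->
  (\int[leb]_(s in `[0%R, L]) G1 s < +oo)%E ->
  (\int[leb]_(s in `[0%R, L]) G2 s < +oo)%E ->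
  (forall s t, 0 <= s -> s < t -> t <= L ->
     (`|H s - H t| <= \int[leb]_(x in `[s, t]) G1 x)%E) ->
  (forall s t, 0 <= s -> s < t -> t <= L ->
     (`|H s - H t| <= \int[leb]_(x in `[s, t]) G2 x)%E) ->
  (`|H 0%R - H L| <= \int[leb]_(s in `[0%R, L]) mine (G1 s) (G2 s))%E.
Proof.
move=> L0 mG1 mG2 G10 G20 fG1 fG2 HG1 HG2.
have sub0L s t : 0 <= s -> t <= L -> `[s, t]%classic `<=` `[0, L]%classic.
  move=> s0 tL x /=; rewrite !in_itv/= => /andP[sx xt].
  by rewrite (le_trans s0)//= (le_trans xt).
(* As L > 0, each s is an endpoint of a nondegenerate subinterval, and a finite [|H s - H t|] forces
   both values to be finite. *)
have Hfin s : 0 <= s <= L -> H s \is a fin_num.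
  move=> /andP[s0 sL].
  have [t [t0 tL Ht]] : exists t, [/\ 0 <= t, t <= L & (`|H s - H t| < +oo)%E].
    have [sL'|] := ltP s L.
      exists L; split => //; first exact: ltW.
      apply: le_lt_trans (HG1 _ _ s0 sL' (lexx L)) _; apply: le_lt_trans fG1.
      by apply: ge0_subset_integral => //; exact: sub0L.
    move=> Ls; have {Ls}sE : s = L by apply/eqP; rewrite eq_le sL.
    exists 0; split => //; first exact: ltW.
    rewrite sE abse_subC; apply: le_lt_trans fG1; exact: HG1.
  by move: Ht; case: (H s) => // ; case: (H t).
pose E := `[0, L]%classic `&` [set x | (G1 x <= G2 x)%E].
have mE : measurable E by exact: measurable_lee.
pose E' := `[0, L]%classic `&` [set x | (G2 x < G1 x)%E].
have mE' : measurable E' by exact: measurable_lte.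
have lebfin A : A `<=` `[0, L]%classic -> measurable A -> (leb A < +oo)%E.
  move=> AL mA; apply: (@le_lt_trans _ _ (leb `[0, L]%classic)).
    by apply: le_measure => //; rewrite inE.
  by rewrite lebesgue_measure_itv/= lte_fin L0 -EFinB ltry.
apply/lee_addgt0Pr => e e0.
have mG : measurable_fun `[0, L] (G1 \+ G2)%E by exact: emeasurable_funD.
have G0 s : `[0, L]%classic s -> (0 <= (G1 \+ G2) s)%E by rewrite adde_ge0.
have fG : (\int[leb]_(s in `[0%R, L]) (G1 \+ G2) s < +oo)%E.
  rewrite (@ge0_integralD _ _ _ leb)//; exact: lte_add_pinfty.
have [del del0 Hdel] := @ge0_integral_abs_cont _ (measurableTypeR R)
  R leb _ _ e (measurable_itv _) mG G0 fG e0.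
have del20 : 0 < del / 2 by exact: divr_gt0.
have [K [cK KE mEK]] :=
  lebesgue_regularity_inner mE (lebfin _ (@subIsetl _ _ _) mE) del20.
have [K' [cK' KE' mEK']] :=
  lebesgue_regularity_inner mE' (lebfin _ (@subIsetl _ _ _) mE') del20.
have clK : closed K by apply: compact_closed => //; exact: Rhausdorff.
have clK' : closed K' by apply: compact_closed => //; exact: Rhausdorff.
have mK : measurable K by exact: closed_measurable.
have mK' : measurable K' by exact: closed_measurable.
(* N is what the compacts miss. Adding [G1 \+ G2] on N costs at most e by absolute continuity and
   makes [Psi] dominate both functions there. *)
pose N : set R := (E `\` K) `|` (E' `\` K').
have mN : measurable N by apply: measurableU; exact: measurableD.
have NL : N `<=` `[0, L]%classic by move=> x [[[]]|[[]]].
have lN : (leb N < del%:E)%E.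
  apply: le_lt_trans (measureU2 _ _ _) _; [exact: measurableD|exact: measurableD|].
  by rewrite (splitr del) EFinD lteD.
pose Psi x := (mine (G1 x) (G2 x) + ((G1 \+ G2)%E \_ N) x)%E.
have GN0 x : (0 <= ((G1 \+ G2)%E \_ N) x)%E.
  by rewrite patchE; case: ifPn => // _; rewrite adde_ge0.
have min0 x : (0 <= mine (G1 x) (G2 x))%E by rewrite le_min G10 G20.
have Psi0 x : (0 <= Psi x)%E by rewrite adde_ge0.
have mmin : measurable_fun `[0, L] (fun x => mine (G1 x) (G2 x)).
  exact: measurable_mine.
have mGN : measurable_fun `[0, L] ((G1 \+ G2)%E \_ N).
  apply/(measurable_restrict _ mN) => //.
  by apply: measurable_funS mG => // x [].
have mPsi : measurable_fun `[0, L] Psi by exact: emeasurable_funD.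
have iPsi : (\int[leb]_(s in `[0%R, L]) Psi s <=
    \int[leb]_(s in `[0%R, L]) mine (G1 s) (G2 s) + e%:E)%E.
  rewrite ge0_integralD// leeD2l// -integral_mkcondr.
  by rewrite setIC (setIidl NL) ltW// Hdel.
apply: le_trans iPsi.
suff : (0 <= L /\ L <= L) /\
    (`|H 0%R - H L| <= \int[leb]_(s in `[0%R, L]) Psi s)%E by case.
apply: (@itv_chain L (fun s t => (s <= t /\ t <= L) /\
   (`|H s - H t| <= \int[leb]_(x in `[s, t]) Psi x)%E)).
- exact: ltW.
- move=> s sP; rewrite lexx; split; first by split => //; case/andP: sP.
  by rewrite subee ?Hfin// abse0 integral_ge0.
- move=> s t w s0 st tw wL [_ Hst] [_ Htw].
  split; first by split => //; exact: le_trans tw.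
  rewrite -(@ge0_integral_itv_cat _ s t w)//; last first.
    by apply: measurable_funS mPsi => //; exact: sub0L.
  apply: (@le_trans _ _ (`|H s - H t| + `|H t - H w|)%E); last exact: leeD.
  by apply: abse_sub_triangle; rewrite Hfin// (le_trans s0)//= (le_trans tw).
- move=> x x0L.
  (* If [Psi] dominates one of the two functions near x, the bound with [Psi] holds on all short
     intervals around x. *)
  have key G : measurable_fun `[0, L] G -> (forall s, (0 <= G s)%E) ->
      (forall s t, 0 <= s -> s < t -> t <= L ->
        (`|H s - H t| <= \int[leb]_(x in `[s, t]) G x)%E) ->
      forall d, (forall y, 0 <= y <= L -> `|y - x| < d -> (G y <= Psi y)%E) ->
      forall s t, 0 <= s -> s <= t -> t <= L -> `|s - x| < d -> `|t - x| < d ->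
        (s <= t /\ t <= L) /\ (`|H s - H t| <= \int[leb]_(x in `[s, t]) Psi x)%E.
    move=> mG' G'0 HG' d Hd s t s0 st tL sx tx; split => //.
    move: st; rewrite le_eqVlt => /predU1P[E1|st].
      subst t; have fs : H s \is a fin_num by rewrite Hfin// s0.
      by rewrite subee// abse0 integral_ge0.
    apply: le_trans (HG' _ _ s0 st tL) _; apply: ge0_le_integral => //.
    + by apply: measurable_funS mG' => //; exact: sub0L.
    + by apply: measurable_funS mPsi => //; exact: sub0L.
    + move=> y /=; rewrite in_itv/= => /andP[sy yt]; apply: Hd.
        by rewrite (le_trans s0)//= (le_trans yt).
      move: sx tx; rewrite !ltr_norml => /andP[h1 h2] /andP[h3 h4].
      by apply/andP; split; lra.
  have PsiN (y : R) : N y -> (G1 y <= Psi y)%E /\ (G2 y <= Psi y)%E.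
    move=> Ny; rewrite /Psi patchE mem_set//; split.
      by rewrite (le_trans _ (leeDr _ _))//= leeDl.
    by rewrite (le_trans _ (leeDr _ _))//= leeDr.
  (* Off K' every point with G2 < G1 lies in N, so G1 <= Psi; likewise G2 <= Psi off K. A point of
     K' has a neighbourhood that avoids K. *)
  have [xK'|xK'] := pselect (K' x).
    have nKx : (~` K) x.
      by move=> /KE [_ /= h]; have [_ /=] := KE' _ xK'; rewrite ltNge h.
    have := open_nbhs_nbhs (conj (closed_openC clK) nKx).
    move=> /nbhs_ballP[d /= d0 Hd]; exists d => //.
    apply: (key G2) => // y yL xy.
    have nKy : ~ K y by apply: Hd; rewrite /ball/= distrC.
    have [h|h] := leP (G1 y) (G2 y).
      by suff /PsiN[] : N (y : R) by []; left; split => //; split => //=; rewrite in_itv.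
    by rewrite /Psi (min_idPr (ltW h)) leeDl.
  have := open_nbhs_nbhs (conj (closed_openC clK') xK').
  move=> /nbhs_ballP[d /= d0 Hd]; exists d => //.
  apply: (key G1) => // y yL xy.
  have nKy : ~ K' y by apply: Hd; rewrite /ball/= distrC.
  have [h|h] := leP (G1 y) (G2 y); first by rewrite /Psi (min_idPl h) leeDl.
  by suff /PsiN[] : N (y : R) by []; right; split => //; split => //=; rewrite in_itv.
Qed.

End OneDimensional.

(** * Lattice property and existence of minimal weak upper gradients *)

Section MinimalWeakUpperGradient.
Context {R : realType} {X : pmetricType R}.
Variable mu : {outer_measure set X -> \bar R}.
Hypothesis borel_cara : forall A : set X, borel_set A -> mu.-caratheodory A.
Implicit Type c : curve X.
Local Notation m := (cara_measure mu).
Local Notation borelX := (g_sigma_algebraType (@open X)).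
Local Notation leb := (@lebesgue_measure R).

Lemma borel_ball (x : X) r : borel_set (ball x r).
Proof.
apply: sub_sigma_algebra; rewrite /= openE => y; rewrite ballEmdist/= => xy.
apply/nbhs_ballP; exists (r - mdist x y); first by rewrite /= subr_gt0.
move=> z; rewrite !ballEmdist/= ltrBrDl; apply: le_lt_trans.
exact: metric_triangle.
Qed.

Lemma measurable_ball_cara (x : X) r :
  measurable (ball x r : set (caratheodory_type mu)).
Proof. by apply: borel_measurable => //; exact: borel_ball. Qed.

Lemma test_densities (s : seq (X -> \bar R)) :
  (forall r, r \in s -> test_density mu r) ->
  exists2 sigma, test_density mu sigma &
    forall c, rectifiable c -> (line_integral c sigma < +oo)%E ->
    forall r, r \in s -> (line_integral c r < +oo)%E.
Proof.
move=> Hs; have [|sigma tsigma H] := @test_density_seq _ _ _ borel_cara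
    (fun n => nth (fun=> 0%E) s n).
  move=> n; have [ns|ns] := ltnP n (size s); first exact/Hs/mem_nth.
  rewrite nth_default//; split => //; first exact: measurable_cst.
  by rewrite integral0.
exists sigma => // c rc fin r rs; have := H c rc fin (index r s).
by rewrite nth_index.
Qed.

Lemma arc_in_ball c (x0 : X) : rectifiable c -> exists n : nat,
  forall s, 0 <= s <= clen c (curve_r c) -> ball x0 n.+1%:R (arc_length_param c s).
Proof.
move=> rc; exists (Num.truncn (mdist x0 (arc_length_param c 0) + clen c (curve_r c))).
move=> s /andP[s0 sL]; rewrite ballEmdist/=; apply: le_lt_trans (truncnS_gt _).
apply: le_trans (metric_triangle _ (arc_length_param c 0) _) _.
rewrite lerD2l; apply: le_trans (mdist_arc rc (lexx 0) s0 sL) _.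
by rewrite subr0.
Qed.

(** A rectifiable curve is bounded, so along it g agrees with its restriction to a large ball around
    [point], and these countably many restrictions are test densities. *)
Lemma integrable_on_balls_density (g : X -> \bar R) : borel_fun g ->
  (forall x, (0 <= g x)%E) -> integrable_on_balls mu g ->
  exists2 sigma, test_density mu sigma & forall c, rectifiable c ->
    (line_integral c sigma < +oo)%E -> (line_integral c g < +oo)%E.
Proof.
move=> mg g0 gb; pose rho n := g \_ (ball (point : X) n.+1%:R).
have rho0 n x : (0 <= rho n x)%E by rewrite /rho patchE; case: ifPn.
have mrho n : borel_fun (rho n).
  have mb : measurable (ball point n.+1%:R : set borelX) by exact: borel_ball.
  apply: (proj1 (@measurable_restrictT _ _ borelX _ _ g mb)).
  exact: (@measurable_funTS _ _ borelX).
have [|sigma tsigma H] := @test_density_seq _ _ _ borel_cara rho.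
  move=> n; split => //.
  by rewrite -integral_mkcond; exact: gb.
exists sigma => // c rc fin.
have [n Hn] := arc_in_ball point rc.
apply: le_lt_trans (H c rc fin n).
apply: line_integral_le => // s sP.
by rewrite /rho patchE mem_set//; exact: Hn.
Qed.

(** A subcurve inherits the finite integral of rho, so it is not exceptional either. *)
Lemma wug_arc (u g rho : X -> \bar R) c : borel_fun g -> (forall x, (0 <= g x)%E) ->
  test_density mu rho ->
  (forall c, rectifiable c -> (line_integral c rho < +oo)%E -> gradient_ineq u g c) ->
  rectifiable c -> (line_integral c rho < +oo)%E ->
  forall s t, 0 <= s -> s < t -> t <= clen c (curve_r c) ->
  (`|u (arc_length_param c s) - u (arc_length_param c t)| <=
   \int[leb]_(x in `[s, t]) g (arc_length_param c x))%E.
Proof.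
move=> mg g0 [mrho rho0 _] H rc fin s t s0 st tL.
have [|t1 /andP[t1l t1r] [V1 _]] := @clen_surj _ _ c s rc.
  by rewrite s0 (le_trans (ltW st)).
have [|t2 /andP[t2l t2r] [V2 _]] := @clen_surj _ _ c t rc.
  by rewrite tL (le_trans s0 (ltW st)).
have t12 : t1 <= t2.
  rewrite leNgt; apply/negP => /ltW t21; have := clen_homo rc t2l t21 t1r.
  by rewrite V1 V2 leNgt st.
have [c' [rc' c'l c'r c'E [lenE liE]]] := subcurve_exists rc t1l t12 t2r.
rewrite V1 V2 in lenE liE.
have := H c' rc'; rewrite liE// => /(_ _)/(_ _).
rewrite /gradient_ineq c'l c'r c'E lenE lte_fin subr_gt0.
rewrite -V1 -V2 !arc_clen ?t1l ?t2l// V1 V2 liE//; apply => //.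
apply: le_lt_trans fin; rewrite line_integralE//; apply: ge0_subset_integral => //.
  exact: measurable_fun_arc.
move=> x /=; rewrite !in_itv/= => /andP[sx xt].
by rewrite (le_trans s0)//= (le_trans xt).
Qed.

Lemma borel_mine (g1 g2 : X -> \bar R) : borel_fun g1 -> borel_fun g2 ->
  borel_fun (fun x => mine (g1 x) (g2 x)).
Proof. by move=> m1 m2; exact: (@measurable_mine _ borelX). Qed.

(** The curves on which g1 or g2 has infinite integral are exceptional by integrability on balls; on
    the others [abse_le_integral_mine] applies in the arc length parameter. *)
Lemma weak_upper_gradient_mine (u g1 g2 : X -> \bar R) :
  weak_upper_gradient mu u g1 -> weak_upper_gradient mu u g2 ->
  integrable_on_balls mu g1 -> integrable_on_balls mu g2 ->
  weak_upper_gradient mu u (fun x => mine (g1 x) (g2 x)).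
Proof.
move=> /(weak_upper_gradientP borel_cara)[m1 g10 [rho1 t1 H1]].
move=> /(weak_upper_gradientP borel_cara)[m2 g20 [rho2 t2 H2]] b1 b2.
have [sig1 ts1 Hs1] := integrable_on_balls_density m1 g10 b1.
have [sig2 ts2 Hs2] := integrable_on_balls_density m2 g20 b2.
apply/(weak_upper_gradientP borel_cara); split.
- exact: borel_mine.
- by move=> x; rewrite le_min g10 g20.
have [|sig ts Hs] := @test_densities [:: rho1; rho2; sig1; sig2].
  by move=> r; rewrite !inE => /or4P[] /eqP ->.
exists sig => // c rc fin; have {}Hs := Hs c rc fin.
have f1 : (line_integral c rho1 < +oo)%E by apply: Hs; rewrite !inE eqxx.
have f2 : (line_integral c rho2 < +oo)%E by apply: Hs; rewrite !inE eqxx !orbT.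
have f3 : (line_integral c g1 < +oo)%E.
  by apply: Hs1 => //; apply: Hs; rewrite !inE eqxx !orbT.
have f4 : (line_integral c g2 < +oo)%E.
  by apply: Hs2 => //; apply: Hs; rewrite !inE eqxx !orbT.
rewrite /gradient_ineq curve_lengthE// lte_fin => L0.
have [<- <-] := arc_ends rc; rewrite line_integralE//.
apply: (@abse_le_integral_mine _ _ (u \o arc_length_param c)
  (g1 \o arc_length_param c) (g2 \o arc_length_param c)) => //.
- exact: measurable_fun_arc.
- exact: measurable_fun_arc.
- by move=> s /=.
- by move=> s /=.
- by move=> s t s0 st tL; exact: (wug_arc m1 g10 t1 H1).
- by move=> s t s0 st tL; exact: (wug_arc m2 g20 t2 H2).
Qed.

Lemma integrable_on_balls_lty (g : X -> \bar R) : borel_fun g ->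
  (forall x, (0 <= g x)%E) -> (\int[m]_x g x < +oo)%E -> integrable_on_balls mu g.
Proof.
move=> mg g0 fin x r; apply: le_lt_trans fin.
apply: ge0_subset_integral => //; first exact: measurable_ball_cara.
exact: borel_fun_measurable.
Qed.

Lemma borel_fun_cvg (h : nat -> X -> \bar R) (g : X -> \bar R) :
  (forall n, borel_fun (h n)) -> (forall x, h ^~ x @ \oo --> g x) -> borel_fun g.
Proof.
move=> mh hg; exact: (@emeasurable_fun_cvg _ borelX _ _ h g).
Qed.

(** Off the curves exceptional for some [h n] and those on which [h 0] has infinite integral,
    dominated convergence applies along each single curve. *)
Lemma weak_upper_gradient_nonincreasing_lim (u g : X -> \bar R)
    (h : nat -> X -> \bar R) :
  (forall n, weak_upper_gradient mu u (h n)) -> (\int[m]_x h 0%N x < +oo)%E ->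
  (forall n x, (h n x <= h 0%N x)%E) -> (forall x, h ^~ x @ \oo --> g x) ->
  weak_upper_gradient mu u g.
Proof.
move=> wh fh0 hle hg.
have mh n : borel_fun (h n) by have [] := wh n.
have h0 n x : (0 <= h n x)%E by have [] := wh n.
have mg : borel_fun g by exact: borel_fun_cvg hg.
have g0 x : (0 <= g x)%E.
  rewrite -(cvg_lim _ (hg x))//; apply: lime_ge; first by apply/cvg_ex; exists (g x).
  exact: nearW.
apply/(weak_upper_gradientP borel_cara); split => //.
have ex n : exists rho, test_density mu rho /\ forall c, rectifiable c ->
    (line_integral c rho < +oo)%E -> gradient_ineq u (h n) c.
  by have /(weak_upper_gradientP borel_cara)[_ _ [rho ? ?]] := wh n; exists rho.
have [rho Hrho] := choice ex.
have [|sig tsig Hsig] := test_density_seq borel_cara (rho := rho).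
  by move=> n; have [] := Hrho n.
have [|tau ttau Htau] := @test_densities [:: sig; h 0%N].
  by move=> r; rewrite !inE => /orP[] /eqP ->.
exists tau => // c rc fin Lc.
have fh : (line_integral c (h 0%N) < +oo)%E.
  by apply: (Htau _ rc fin); rewrite !inE eqxx orbT.
have Hn n : (`|u (c (curve_l c)) - u (c (curve_r c))| <= line_integral c (h n))%E.
  have [_] := Hrho n; apply => //; apply: Hsig => //.
  by apply: (Htau _ rc fin); rewrite !inE eqxx.
have [] := @dominated_convergence _ (measurableTypeR R) R leb
    `[0, clen c (curve_r c)]%classic (measurable_itv _)
    (fun n => h n \o arc_length_param c) (g \o arc_length_param c)
    (h 0%N \o arc_length_param c).
- by move=> n; exact: measurable_fun_arc.
- exact: measurable_fun_arc.
- by apply: aeW => s _; exact: hg.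
- apply/integrableP; split; first exact: measurable_fun_arc.
  have := fh; rewrite line_integralE//; congr (_ < _)%E.
  by apply: eq_integral => s _; rewrite /= gee0_abs.
- by apply: aeW => s n _ /=; rewrite gee0_abs.
move=> _ _ cvgI; rewrite line_integralE//.
have -> := esym (cvg_lim _ cvgI); last by [].
apply: lime_ge; first by apply/cvg_ex; eexists; exact: cvgI.
by apply: nearW => n /=; have := Hn n; rewrite line_integralE.
Qed.

(** The minimum is at most g but has the same finite integral. Comparing on a set and on its
    complement shows that the integrals agree on every measurable set, so the minimum equals g
    almost everywhere. *)
Lemma le_integral_mine_ae (g k : X -> \bar R) : borel_fun g -> borel_fun k ->
  (forall x, (0 <= g x)%E) -> (forall x, (0 <= k x)%E) ->
  (\int[m]_x g x < +oo)%E ->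
  (\int[m]_x g x <= \int[m]_x mine (g x) (k x))%E ->
  {ae m, forall x, (g x <= k x)%E}.
Proof.
move=> mg mk g0 k0 fg le.
have mgk : borel_fun (fun x => mine (g x) (k x)) by exact: borel_mine.
have min0 x : (0 <= mine (g x) (k x))%E by rewrite le_min g0 k0.
have intg : m.-integrable setT g.
  apply/integrableP; split; first exact: borel_fun_measurable.
  rewrite (_ : (\int[m]_x `|g x|)%E = (\int[m]_x g x)%E)//.
  by apply: eq_integral => x _; rewrite gee0_abs.
have ming x : (mine (g x) (k x) <= g x)%E by rewrite ge_min lexx.
have leE E : measurable E ->
    (\int[m]_(x in E) mine (g x) (k x) <= \int[m]_(x in E) g x)%E.
  move=> mE; apply: ge0_le_integral => //.
    by apply: measurable_funTS; exact: borel_fun_measurable.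
  by apply: measurable_funTS; exact: borel_fun_measurable.
have := @integral_ae_eq _ _ _ m setT measurableT (fun x => mine (g x) (k x)) g intg.
move=> /(_ (borel_fun_measurable borel_cara mgk))/(_ _)[|].
  move=> E _ mE; apply/eqP; rewrite eq_le leE// andbT.
  have finE F : measurable F -> (\int[m]_(x in F) g x)%E \is a fin_num.
    by move=> mF; apply: integrable_fin_num => //; exact: integrableS intg.
  have finEm F : measurable F -> (\int[m]_(x in F) mine (g x) (k x))%E \is a fin_num.
    move=> mF; rewrite ge0_fin_numE ?integral_ge0//; apply: le_lt_trans (leE _ mF) _.
    by rewrite -ge0_fin_numE ?finE// integral_ge0.
  have mEC : measurable (~` E) by exact: measurableC.
  have split_int f : borel_fun f -> (forall x, (0 <= f x)%E) ->
      (\int[m]_x f x = \int[m]_(x in E) f x + \int[m]_(x in ~` E) f x)%E.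
    move=> mf f0; rewrite -(setUv E) ge0_integral_setU//.
    - by rewrite setUv; exact: borel_fun_measurable.
    - by apply/disj_setPS => x [].
  rewrite split_int// [leRHS]split_int// in le.
  have := leE _ mEC; move: le.
  rewrite -(fineK (finE _ mE)) -(fineK (finE _ mEC)).
  rewrite -(fineK (finEm _ mE)) -(fineK (finEm _ mEC)).
  by rewrite -!EFinD !lee_fin; lra.
move=> N [mN N0 HN]; exists N; split => // x /= gk; apply: HN => /= /(_ I) E.
by apply: gk; rewrite E ge_min lexx orbT.
Qed.

Theorem minimal_weak_upper_gradient_exists (u g0 : X -> \bar R) :
  weak_upper_gradient mu u g0 -> (\int[m]_x g0 x < +oo)%E ->
  exists g, minimal_weak_upper_gradient mu u g.
Proof.
move=> wg0 fg0.
pose W := [set g | weak_upper_gradient mu u g /\ (\int[m]_x g x < +oo)%E].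
pose J := ereal_inf [set (\int[m]_x g x)%E | g in W].
have J0 : (0 <= J)%E.
  by apply: le_ereal_inf_tmp => _ [g [[_ g0' _] _] <-]; exact: integral_ge0.
have Jfin : J \is a fin_num.
  rewrite ge0_fin_numE//; apply: le_lt_trans (fg0); apply: ereal_inf_lbound.
  by exists g0.
have ex n : exists g, W g /\ (\int[m]_x g x <= J + (n.+1%:R^-1)%:E)%E.
  have [||_ [g Wg <-] le] := @lb_ereal_inf_adherent _
    [set (\int[m]_x g x)%E | g in W] n.+1%:R^-1.
  - by rewrite invr_gt0.
  - exact: Jfin.
  - by exists g; split => //; exact: ltW.
have [gs Hgs] := choice ex.
pose h := fix h n : X -> \bar R :=
  if n is n'.+1 then fun x => mine (h n' x) (gs n x) else gs 0%N.
have onb g : W g -> integrable_on_balls mu g.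
  by move=> [[mg g0' _] fg]; exact: integrable_on_balls_lty.
(* Here g2 is merely integrable on balls, yet its minimum with an integrable g1 falls back into W.
   In this way g, constructed inside W, is compared with all competitors in the definition of
   minimality. *)
have Wmin g1 g2 : W g1 -> weak_upper_gradient mu u g2 -> integrable_on_balls mu g2 ->
    W (fun x => mine (g1 x) (g2 x)).
  move=> W1 w2 b2; have b1 := onb _ W1; have [w1 f1] := W1; split.
    exact: weak_upper_gradient_mine.
  have [m1 p1 _] := w1; have [m2 p2 _] := w2.
  apply: le_lt_trans f1; apply: ge0_le_integral => //.
  - by move=> x _; rewrite le_min p1 p2.
  - by apply: borel_fun_measurable => //; exact: borel_mine.
  - exact: borel_fun_measurable.
  - by move=> x _; rewrite ge_min lexx.
have Wh n : W (h n).
  elim: n => [|n IH] /=; first by have [] := Hgs 0%N.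
  by have [Wn _] := Hgs n.+1; apply: Wmin => //; [case: Wn|exact: onb].
have hS n x : (h n.+1 x <= h n x)%E by rewrite /= ge_min lexx.
have hgs n x : (h n x <= gs n x)%E by case: n => //= n; rewrite ge_min lexx orbT.
have hni x : nonincreasing_seq (h ^~ x).
  by apply/nonincreasing_seqP => n; exact: hS.
have hcvg x := ereal_nonincreasing_cvgn (hni x).
pose g x := ereal_inf (range (h ^~ x)).
have wg : weak_upper_gradient mu u g.
  apply: (@weak_upper_gradient_nonincreasing_lim _ _ h) => //.
  - by move=> n; have [] := Wh n.
  - by have [] := Wh 0%N.
  - by move=> n x; exact: hni.
have [mg g_ge0 _] := wg.
have gh n x : (g x <= h n x)%E by apply: ereal_inf_lbound; exists n.
have ghI n : (\int[m]_x g x <= \int[m]_x h n x)%E.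
  have [[mh h0 _] _] := Wh n.
  by apply: ge0_le_integral => //; exact: borel_fun_measurable.
have fg : (\int[m]_x g x < +oo)%E.
  by apply: le_lt_trans (ghI 0%N) _; have [] := Wh 0%N.
have Wg : W g by [].
have gJ : (\int[m]_x g x <= J)%E.
  apply/lee_addgt0Pr => e e0.
  pose n := Num.truncn e^-1.
  have ne : n.+1%:R^-1 <= e.
    by rewrite -[leRHS]invrK lef_pV2 ?posrE ?invr_gt0// ltW// truncnS_gt.
  apply: le_trans (ghI n) _; have [_ Jn] := Hgs n.
  apply: (@le_trans _ _ (\int[m]_x gs n x)%E); last first.
    by apply: le_trans Jn _; rewrite leeD2l// lee_fin.
  have [[mh h0 _] _] := Wh n; have [[[mgs _ _] _] _] := Hgs n.
  by apply: ge0_le_integral => //; exact: borel_fun_measurable.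
exists g; split => //; first exact: onb.
move=> k wk bk; have [mk k0 _] := wk.
apply: le_integral_mine_ae => //.
apply: le_trans gJ _; apply: ereal_inf_lbound.
by exists (fun x => mine (g x) (k x)) => //; exact: Wmin.
Qed.

End MinimalWeakUpperGradient.

(** * Sobolev inequality implies non-amenability *)

Section Counting.
Context {R : realType} {X : pmetricType R}.

Lemma size_le_card (T : choiceType) (A : set T) (s : seq T) n : uniq s ->
  (forall x, x \in s -> A x) -> (A #<= `I_n)%card -> (size s <= n)%N.
Proof.
move=> us sA An.
have -> : size s = #|` [fset x in s]%fset|.
  by rewrite card_fseq undup_id.
rewrite -(set_fsetK [fset x in s]%fset); apply: geq_card_fset_set.
apply: card_le_trans An; apply: subset_card_le => x /=.
by rewrite inE; exact: sA.
Qed.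

Lemma count_near_le (G : set X) (r : R) n (s : seq X) (x : X) : uniq s ->
  (forall p, p \in s -> G p) -> (G `&` ball x r #<= `I_n)%card ->
  (count (fun p => (mdist x p < r)%R) s <= n)%N.
Proof.
move=> us sG Gn; rewrite -size_filter.
apply: size_le_card Gn; first exact: filter_uniq.
by move=> p; rewrite mem_filter => /andP[xp /sG Gp]; split => //; rewrite ballEmdist.
Qed.

Variable mu : {outer_measure set X -> \bar R}.
Hypothesis borel_cara : forall A : set X, borel_set A -> mu.-caratheodory A.
Local Notation m := (cara_measure mu).

(** Bounded overlap: the count in the hypothesis is the number of balls of the family that contain
    x. *)
Lemma overlap_integral_le (s : seq X) (r : R) (n : nat) (h : X -> \bar R) :
  measurable_fun setT (h : caratheodory_type mu -> \bar R) ->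
  (forall x, (0 <= h x)%E) ->
  (forall x, (count (fun p => (mdist x p < r)%R) s <= n)%N) ->
  (\sum_(p <- s) \int[m]_(x in ball p r) h x <= n%:R%:E * \int[m]_x h x)%E.
Proof.
move=> mh h0 cn.
have mb p : measurable (ball p r : set (caratheodory_type mu)).
  exact: measurable_ball_cara.
have hb0 p x : (0 <= (h \_ (ball p r)) x)%E by rewrite patchE; case: ifPn.
have mhb p : measurable_fun setT (h \_ (ball p r) : caratheodory_type mu -> \bar R).
  by apply: (proj1 (measurable_restrictT _ (mb p))); exact: measurable_funTS.
under eq_bigr do rewrite integral_mkcond.
rewrite -ge0_integral_sum//.
rewrite -ge0_integralZl_EFin//; apply: ge0_le_integral => //.
- by move=> x _; exact: sume_ge0.
- exact: emeasurable_sum.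
- exact: measurable_funeM.
move=> x _; apply: (@le_trans _ _
    ((count (fun p => (mdist x p < r)%R) s)%:R%:E * h x)%E); last first.
  by rewrite lee_wpmul2r// lee_fin ler_nat.
elim: s {cn} => [|p s IH]; first by rewrite big_nil mul0e.
rewrite big_cons /= natrD EFinD ge0_muleDl ?lee_fin//; apply: leeD => //.
rewrite patchE; case: ifPn => [|_]; last by rewrite mule_ge0// lee_fin.
by rewrite inE ballEmdist/= metric_sym => ->; rewrite mul1e.
Qed.

End Counting.

(** * The upper gradient of a 1-Lipschitz cutoff function *)

Section LipschitzUpperGradient.
Context {R : realType} {X : pmetricType R}.
Local Notation leb := (@lebesgue_measure R).
Local Notation borelX := (g_sigma_algebraType (@open X)).

(** In spite of the name, this is the sloping part of a function with values in [0, 1]; the flat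
    parts are the levels 0 and 1. *)
Definition plateau (u : X -> R) : set X := [set x | 0 < u x < 1].

Lemma lipschitz_open (u : X -> R) (a b : R) :
  (forall x y, `|u x - u y| <= mdist x y) -> open [set x | a < u x < b].
Proof.
move=> lu; rewrite openE => x /= /andP[ax xb].
apply/nbhs_ballP; exists (Num.min (u x - a) (b - u x)).
  by rewrite /= lt_min !subr_gt0 ax.
move=> y; rewrite ballEmdist/= lt_min => /andP[h1 h2].
have := lu x y; rewrite ler_norml => /andP[h3 h4].
by apply/andP; split; lra.
Qed.

Lemma lipschitz_borel (u : X -> R) :
  (forall x y, `|u x - u y| <= mdist x y) -> borel_fun (EFin \o u).
Proof.
move=> lu; apply/(@measurable_EFinP _ borelX).
apply: (@measurability _ _ borelX _ _ _ _ (RGenOInfty.measurableE R)).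
move=> _ [_ [a ->] <-]; rewrite setTI; apply: sub_sigma_algebra.
rewrite /= openE => x /=; rewrite in_itv/= andbT => ax.
apply/nbhs_ballP; exists (u x - a); first by rewrite /= subr_gt0.
move=> y; rewrite ballEmdist/= in_itv/= andbT => h1.
have := lu x y; rewrite ler_norml => /andP[h3 h4]; lra.
Qed.

(** In arc length u is 1-Lipschitz along the curve, so its change is at most the time that the curve
    spends where 0 < u < 1. *)
Lemma plateau_upper_gradient (u : X -> R) :
  (forall x y, `|u x - u y| <= mdist x y) -> (forall x, 0 <= u x <= 1) ->
  upper_gradient (EFin \o u) (EFin \o \1_(plateau u)).
Proof.
move=> lu u01.
have bg : borel_fun (EFin \o \1_(plateau u) : X -> \bar R).
  apply/(@measurable_EFinP _ borelX); apply: (@measurable_indic _ borelX).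
  by apply: sub_sigma_algebra; exact: lipschitz_open.
split => // [x|c rc].
  by rewrite lee_fin indicE; case: (_ \in _).
rewrite /gradient_ineq curve_lengthE// lte_fin => L0.
rewrite line_integralE//; have [<- <-] := arc_ends rc.
set L := clen c _; set h := u \o arc_length_param c.
have mI := measurable_fun_arc rc bg; rewrite -/L in mI.
have I0 s : (0 <= ((EFin \o \1_(plateau u)) \o arc_length_param c) s)%E.
  by rewrite lee_fin indicE; case: (_ \in _).
have hl s t : 0 <= s -> s <= t -> t <= L -> `|h s - h t| <= t - s.
  by move=> s0 st tL; apply: le_trans (lu _ _) _; exact: mdist_arc.
have h01 s : 0 <= h s <= 1 := u01 _.
(* Clamping to [e, 1 - e] makes the estimate local. *)
apply/lee_addgt0Pr => e' e'0; pose e := e' / 2.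
have e0 : 0 < e by exact: divr_gt0.
pose k s := Num.max e (Num.min (1 - e) (h s)).
have kh s : `|k s - h s| <= e.
  have /andP[? ?] := h01 s; rewrite /k ler_norml.
  by case: (leP (1 - e) (h s)) => ?; [case: (leP e (1 - e)) => ?|
    case: (leP e (h s)) => ?]; apply/andP; split; lra.
have kl s t : `|k s - k t| <= `|h s - h t|.
  by apply: le_trans (ler_dist_max _ _ _) _; exact: ler_dist_min.
suff H : (`|k 0 - k L|%:E <= \int[leb]_(x in `[0%R, L])
    ((EFin \o \1_(plateau u)) \o arc_length_param c) x)%E.
  apply: (@le_trans _ _ (`|k 0 - k L| + e')%:E); last by rewrite EFinD leeD2r.
  rewrite -[leLHS]/(`|h 0 - h L|%:E) lee_fin.
  have ee : e + e = e' by rewrite -splitr.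
  have := kh 0; have := kh L; rewrite !ler_norml => /andP[? ?] /andP[? ?].
  have ? := ler_norm (k 0 - k L); have := ler_norm (- (k 0 - k L)).
  by rewrite normrN => ?; apply/andP; split; lra.
apply: (@itv_chain R L (fun s t => (`|k s - k t|%:E <= \int[leb]_(x in `[s, t])
    ((EFin \o \1_(plateau u)) \o arc_length_param c) x)%E)).
- exact: ltW.
- by move=> s _; rewrite subrr normr0 integral_ge0.
- move=> s t w s0 st tw wL Hst Htw.
  rewrite -(@ge0_integral_itv_cat _ _ s t w)//; last first.
    apply: measurable_funS mI => // x /=; rewrite !in_itv/= => /andP[sx xw].
    by rewrite (le_trans s0)//= (le_trans xw).
  apply: le_trans _ (leeD Hst Htw); rewrite -EFinD lee_fin.
  by apply: le_trans (ler_normD _ _); rewrite addrA subrK.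
- move=> x /andP[x0 xL].
  have hd s : 0 <= s -> s <= L -> `|h s - h x| <= `|s - x|.
    move=> s0 sL; have [sx|/ltW xs] := leP s x.
      by apply: le_trans (hl _ _ s0 sx xL) _; rewrite -normrN opprB ler_norm.
    by rewrite distrC; apply: le_trans (hl _ _ x0 xs sL) _; exact: ler_norm.
  (* Near x the clamped function is constant if h x < e or h x > 1 - e. Otherwise h stays strictly
     between 0 and 1 within distance e of x, where the indicator is therefore 1. *)
  have [hx|hx] := ltP (h x) e.
    exists (e - h x); rewrite ?subr_gt0// => s t s0 st tL sx tx.
    have ke y : 0 <= y -> y <= L -> `|y - x| < e - h x -> k y = e.
      move=> y0 yL yx; have := le_lt_trans (hd y y0 yL) yx.
      rewrite ltr_norml => /andP[_ ?]; rewrite /k max_l// ge_min.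
      by apply/orP; right; lra.
    rewrite !ke// ?(le_trans st)// ?(le_trans s0)// subrr normr0 integral_ge0//.
  have [hx'|hx'] := ltP (1 - e) (h x).
    exists (h x - (1 - e)); rewrite ?subr_gt0// => s t s0 st tL sx tx.
    have ke y : 0 <= y -> y <= L -> `|y - x| < h x - (1 - e) -> k y = Num.max e (1 - e).
      move=> y0 yL yx; have := le_lt_trans (hd y y0 yL) yx.
      rewrite ltr_norml => /andP[? _]; rewrite /k min_l//; lra.
    rewrite !ke// ?(le_trans st)// ?(le_trans s0)// subrr normr0 integral_ge0//.
  exists e => // s t s0 st tL sx tx.
  apply: (@le_trans _ _ (\int[leb]_(x in `[s, t]) 1)%E); last first.
    apply: ge0_le_integral => //.
      apply: measurable_funS mI => // y /=; rewrite !in_itv/= => /andP[sy yt].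
      by rewrite (le_trans s0)//= (le_trans yt).
    move=> y /=; rewrite in_itv/= => /andP[sy yt]; rewrite lee_fin indicE mem_set//.
    have yx : `|y - x| < e.
      move: sx tx; rewrite !ltr_norml => /andP[? ?] /andP[? ?].
      by apply/andP; split; lra.
    have := le_lt_trans (hd y (le_trans s0 sy) (le_trans yt tL)) yx.
    rewrite ltr_norml => /andP[? ?].
    by suff : 0 < h y < 1 by []; apply/andP; split; lra.
  rewrite integral_cst// mul1e.
  rewrite -[leRHS]/(leb `[s, t]%classic) lebesgue_measure_itv/= lte_fin.
  apply: (@le_trans _ _ (t - s)%:E).
    by rewrite lee_fin; apply: le_trans (kl _ _) _; exact: hl.
  by case: ltP => // ts; rewrite lee_fin subr_le0.
Qed.

End LipschitzUpperGradient.

(** * The test function of a finite set of lattice points *)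

Section SobolevNonAmenable.
Context {R : realType} {X : pmetricType R}.

(** C will be the covering radius of the lattice: where the function is below 1, every lattice point
    within C lies outside s. One more unit of radius lets slope 1 come down to 0. *)
Definition bump (C : R) (s : seq X) (x : X) : R :=
  foldr (fun p a => Num.max (Num.max 0 (Num.min 1 (C + 1 - mdist p x))) a) 0 s.

Lemma bump01 C s x : 0 <= bump C s x <= 1.
Proof.
elim: s => [|p s /andP[IH0 IH1]] /=; first by rewrite lexx ler01.
by rewrite le_max IH0 orbT/= !ge_max ler01 ge_min lexx IH1.
Qed.

Lemma bump_lipschitz C s x y : `|bump C s x - bump C s y| <= mdist x y.
Proof.
elim: s => [|p s] /=; first by rewrite subrr normr0 mdist_ge0.
rewrite ler_norml => /andP[h1 h2].
have h3 := metric_triangle p x y; have h4 := metric_triangle p y x.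
rewrite (metric_sym y x) in h4; have h5 := mdist_ge0 x y.
set a := mdist p x in h3 h4 *; set b := mdist p y in h3 h4 *.
set A := bump C s x in h1 h2 *; set B := bump C s y in h1 h2 *.
have clampl u v : u <= v + mdist x y ->
    Num.max 0 (Num.min 1 u) <= Num.max 0 (Num.min 1 v) + mdist x y.
  move=> uv; case: (leP 1 u) => ?; case: (leP 1 v) => ?; rewrite ?(max_idPr ler01);
  case: (leP 0 u) => ?; case: (leP 0 v) => ?; lra.
have maxl u v u' v' : u <= v + mdist x y -> u' <= v' + mdist x y ->
    Num.max u u' <= Num.max v v' + mdist x y.
  by move=> ? ?; case: (leP u u') => ?; case: (leP v v') => ?; lra.
have m1 : Num.max (Num.max 0 (Num.min 1 (C + 1 - a))) A <=
   Num.max (Num.max 0 (Num.min 1 (C + 1 - b))) B + mdist x y.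
  by apply: maxl; [apply: clampl; lra|lra].
have m2 : Num.max (Num.max 0 (Num.min 1 (C + 1 - b))) B <=
   Num.max (Num.max 0 (Num.min 1 (C + 1 - a))) A + mdist x y.
  by apply: maxl; [apply: clampl; lra|lra].
by rewrite ler_norml; apply/andP; split; lra.
Qed.

Lemma bump_eq1 C s p x : p \in s -> mdist p x <= C -> bump C s x = 1.
Proof.
move=> + pC; elim: s => // q s IH; rewrite inE => /predU1P[<-|/IH E] /=.
  have /andP[_ h] := bump01 C s x.
  by rewrite min_l ?lerBrDl ?lerD2r// (max_idPr ler01) max_l.
by rewrite E max_r// ge_max ler01 ge_min lexx.
Qed.

Lemma bump_gt0 C s x : 0 < bump C s x -> exists2 p, p \in s & mdist p x < C + 1.
Proof.
elim: s => [|q s IH] /=; first by rewrite ltxx.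
rewrite lt_max => /orP[|/IH[p ps px]]; last by exists p => //; rewrite inE ps orbT.
rewrite lt_max ltxx lt_min ltr01/= subr_gt0 => qx.
by exists q => //; rewrite inE eqxx.
Qed.

Variable mu : {outer_measure set X -> \bar R}.
Local Notation m := (cara_measure mu).

Lemma dist_to_lt (A : set X) (x : X) (r : R) :
  (dist_to A x < r%:E)%E <-> exists2 y, A y & mdist x y < r.
Proof.
split=> [/ereal_inf_lt[_ [y Ay <-]]|[y Ay xy]]; first by rewrite lte_fin; exists y.
by apply: le_lt_trans (ereal_inf_lbound _) _; [exists y; [exact: Ay|reflexivity]|].
Qed.

Lemma boundary_finite (G : set X) (r : R) (F : {fset X}) (N : nat) :
  (forall x, (G `&` ball x r #<= `I_N)%card) -> finite_set (boundary G r [set` F]).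
Proof.
move=> GN; apply: (@sub_finite_set _ _ (\bigcup_(p in [set` F]) (G `&` ball p r))).
  move=> x [Gx /dist_to_lt[p Fp xp] _]; exists p => //; split => //.
  by rewrite ballEmdist/= metric_sym.
apply: bigcup_finite => // p _; apply/finite_set_leP; exists N; exact: GN.
Qed.

Theorem S11_non_amenable : metric_measure_space mu -> uniform_space mu ->
  S11 mu -> non_amenable X.
Proof.
move=> [[borel_cara _] _ _] [f [g [fg0 _ Hfg]]] [CS CS0 HS] [G [[C C0 GC] [N GN]] am].
have [f0 g0] := fg0 _ C0.
(* With B the boundary of F, the estimates below combine to #F f(C) <= N(C) int u <= N(C) CS int gm
   <= K #B. A ratio #B / #F below f(C) / (K + 1) contradicts this; the added 1 covers K = 0. *)
pose K := (N C)%:R * (CS * g C).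
have K0 : 0 <= K by rewrite !mulr_ge0// ltW.
have eps0 : 0 < f C / (K + 1) by rewrite divr_gt0// ltr_wpDl.
(* A point with 0 < u < 1 is within C of a lattice point q and within C + 1 of F, so q is within 2C
   + 1 of F. *)
have r0 : 0 < 2 * C + 1 by lra.
have [F [Fn0 FG FB]] := am _ _ eps0 r0.
set u := bump C F.
have lu x y : `|u x - u y| <= mdist x y by exact: bump_lipschitz.
have u01 x : 0 <= u x <= 1 by exact: bump01.
have bu : borel_fun (EFin \o u) by exact: lipschitz_borel.
have mu_ := borel_fun_measurable borel_cara bu.
have u0E x : (0 <= (EFin \o u) x)%E by rewrite lee_fin; case/andP: (u01 x).
set B := fset_set (boundary G (2 * C + 1) [set` F]) in FB.
have finB : finite_set (boundary G (2 * C + 1) [set` F]).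
  by apply: (@boundary_finite _ _ _ (N (2 * C + 1))) => x; exact: GN.
have up := plateau_upper_gradient lu u01.
have [bI I0 _] := up.
(* A plateau point is near a lattice point outside F, hence of the boundary. *)
have platB x : plateau u x -> exists2 q, q \in B & mdist q x < C.
  move=> /andP[ux0 ux1].
  have : [set x | (dist_to G x < C%:E)%E] x by rewrite GC.
  move=> /dist_to_lt[q Gq xq]; exists q; last by rewrite metric_sym.
  have qF : q \notin F.
    apply/negP => qF; move: ux1; rewrite /u (bump_eq1 qF) ?ltxx// metric_sym.
    exact: ltW.
  have [p pF px] := bump_gt0 ux0.
  rewrite /B in_fset_set// inE; split => //; apply/dist_to_lt.
    exists p => //; apply: le_lt_trans (metric_triangle q x p) _.
    by rewrite (metric_sym q) (metric_sym x p); lra.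
  by exists q; [split => //; exact/negP|rewrite mdistxx].
have mIm := borel_fun_measurable borel_cara bI.
have intI : (\int[m]_x (\1_(plateau u) x)%:E <= (#|` B|%:R * g C)%:E)%E.
  apply: (@le_trans _ _ (\sum_(q <- B) mu (ball q C))%E).
    have -> : (\sum_(q <- B) mu (ball q C) =
        \int[m]_x (\sum_(q <- B) (\1_(ball q C) x)%:E))%E.
      rewrite ge0_integral_sum//.
      - apply: eq_bigr => q _; rewrite integral_indic// ?setIT//.
        exact: measurable_ball_cara.
      - move=> q; apply/measurable_EFinP; apply: measurable_indic.
        exact: measurable_ball_cara.
    apply: ge0_le_integral => //.
    - apply: emeasurable_sum => q; apply/measurable_EFinP; apply: measurable_indic.
      exact: measurable_ball_cara.
    - move=> x _; rewrite indicE.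
      case: (boolP (x \in _)) => [/[!inE] /platB[q qB qx]|_].
        rewrite (big_rem q)//= indicE mem_set ?ballEmdist//=.
        by rewrite leeDl// sume_ge0// => q' _; rewrite lee_fin.
      by apply: sume_ge0 => q' _; rewrite lee_fin.
  apply: (@le_trans _ _ (\sum_(q <- B) (g C)%:E)%E).
    by apply: lee_sum => q _; case/andP: (Hfg q _ C0).
  by rewrite sumEFin lee_fin big_const_seq count_predT iter_addr_0 mulr_natl.
(* The sum of all distances from p0 is a crude bound for each of them. *)
have [x0 [rho rho0 Hrho]] : exists x0 : X, exists2 rho : R,
    0 < rho & forall z, 0 < u z -> mdist x0 z < rho.
  have [p0 p0F] := fset0Pn _ Fn0; exists p0.
  have S0 : 0 <= \sum_(p <- F) mdist p0 p by apply: sumr_ge0 => p _; exact: mdist_ge0.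
  exists (\sum_(p <- F) mdist p0 p + (C + 1)); first by lra.
  move=> z /bump_gt0[p pF pz]; apply: le_lt_trans (metric_triangle p0 p z) _.
  apply: ler_ltD => //; rewrite (big_rem p)//= lerDl.
  by apply: sumr_ge0 => q _; exact: mdist_ge0.
have u_eq0 z : ~ mdist x0 z < rho -> u z = 0.
  move=> H; apply/eqP; rewrite eq_le; case/andP: (u01 z) => -> _; rewrite andbT.
  by rewrite leNgt; apply/negP => /Hrho.
have bs : bounded_support (EFin \o u).
  exists x0, (rho + 1) => y cly; rewrite ballEmdist/=.
  have [z [/= uz]] := cly _ (nbhsx_ballx y 1 ltr01).
  rewrite ballEmdist/= => yz; apply: le_lt_trans (metric_triangle x0 z y) _.
  rewrite metric_sym in yz; apply: ltrD => //.
  have [//|/negP H] := boolP (mdist x0 z < rho).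
  by move: uz; rewrite u_eq0// eqxx.
have intu : m.-integrable setT (EFin \o u).
  apply/integrableP; split => //.
  apply: (@le_lt_trans _ _ (mu (ball x0 rho))); last first.
    by case/andP: (Hfg x0 _ rho0) => _ /le_lt_trans; apply; exact: ltry.
  have mb : measurable (ball x0 rho : set (caratheodory_type mu)).
    exact: measurable_ball_cara.
  rewrite -[leRHS](_ : (\int[m]_x (\1_(ball x0 rho) x)%:E)%E = _); last first.
    by rewrite integral_indic// setIT.
  apply: ge0_le_integral => //.
  - by apply: measurableT_comp.
  - by apply/measurable_EFinP; exact: measurable_indic.
  - move=> z _; rewrite gee0_abs// lee_fin indicE.
    have [xz|xz] := boolP (mdist x0 z < rho).
      by rewrite mem_set ?ballEmdist//; case/andP: (u01 z).
    by rewrite u_eq0//; exact/negP.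
have fI : (\int[m]_x (EFin \o \1_(plateau u)) x < +oo)%E.
  exact: le_lt_trans intI (ltry _).
have Nu : N11 mu (EFin \o u).
  split => //; exists (EFin \o \1_(plateau u)) => //.
  apply/integrableP; split => //; apply: le_lt_trans (fI).
  rewrite le_eqVlt; apply/orP; left; apply/eqP/eq_integral => x _.
  by rewrite gee0_abs.
have wup : weak_upper_gradient mu (EFin \o u) (EFin \o \1_(plateau u)).
  split => //; exists set0 => //; last by move=> c rc _; case: up => _ _; exact.
  apply/(modulus1_eq0 borel_cara); exists (cst 0%E) => //; split => //.
    exact: measurable_cst.
  by rewrite integral0.
have [gm gmin] := minimal_weak_upper_gradient_exists borel_cara wup fI.
have HSu := HS _ Nu bs _ gmin.
have gI : (\int[m]_x gm x <= \int[m]_x (\1_(plateau u) x)%:E)%E.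
  have [[mgm gm0 _] _ Hmin] := gmin.
  apply: ae_ge0_le_integral => //; first exact: borel_fun_measurable.
  have := Hmin _ wup (integrable_on_balls_lty borel_cara bI I0 fI).
  move=> [N' [mN' N'0 HN']]; exists N'; split => // x /= H.
  by apply: HN' => /= H2; apply: H.
(* The balls of radius C around F carry u = 1, have mass at least f(C), and overlap at most N(C)
   times. *)
have low : ((#|` F|%:R * f C)%:E <= (N C)%:R%:E * \int[m]_x (EFin \o u) x)%E.
  apply: le_trans (@overlap_integral_le _ _ _ borel_cara F C (N C) _ mu_ u0E _); last first.
    move=> x; apply: (@count_near_le _ _ G); first exact: fset_uniq.
      by move=> p /FG.
    exact: GN.
  apply: (@le_trans _ _ (\sum_(p <- F) (f C)%:E)%E).
    by rewrite sumEFin lee_fin big_const_seq count_predT iter_addr_0 mulr_natl.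
  rewrite !big_seq; apply: lee_sum => p pF.
  apply: (@le_trans _ _ (mu (ball p C))); first by case/andP: (Hfg p _ C0).
  have mb : measurable (ball p C : set (caratheodory_type mu)).
    exact: measurable_ball_cara.
  rewrite -[leLHS]mul1e -[leLHS](@integral_cst _ _ _ m)//.
  apply: ge0_le_integral => //; first exact: measurable_funTS.
  move=> x; rewrite ballEmdist/= => px; rewrite lee_fin /u (bump_eq1 pF)//; exact: ltW.
have F0 : 0 < #|` F|%:R :> R by rewrite ltr0n cardfs_gt0.
have main : #|` F|%:R * f C <= K * #|` B|%:R.
  rewrite -lee_fin; apply: le_trans low _.
  apply: (@le_trans _ _ ((N C)%:R%:E * (CS%:E * (#|` B|%:R * g C)%:E))%E).
    rewrite lee_wpmul2l ?lee_fin//.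
    apply: (@le_trans _ _ (\int[m]_x `|(EFin \o u) x|)%E).
      rewrite le_eqVlt; apply/orP; left; apply/eqP/eq_integral => x _.
      by rewrite gee0_abs.
    apply: le_trans HSu _; rewrite lee_wpmul2l ?lee_fin ?(ltW CS0)//.
    exact: le_trans gI intI.
  by rewrite -!EFinM lee_fin /K le_eqVlt; apply/orP; left; apply/eqP; ring.
move: FB; rewrite ltr_pdivrMr// => FB.
have : #|` F|%:R * f C <= #|` F|%:R * (K * (f C / (K + 1))).
  apply: le_trans main _; rewrite mulrCA ler_wpM2l//.
  by rewrite mulrC ltW.
rewrite ler_pM2l// mulrA ler_pdivlMr ?ltr_wpDl//.
by rewrite mulrDr mulr1 mulrC gerDl leNgt f0.
Qed.

End SobolevNonAmenable.

(** * Isoperimetry on quasi-lattices *)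

Section Coarea.
Context {R : realType} {T : choiceType}.

Lemma sum_pos_subr_ge0 (A B : seq T) (w : T -> T -> R) (phi : T -> R) :
  (forall p q, 0 <= w p q) ->
  0 <= \sum_(p <- A) \sum_(q <- B) w p q * Num.max 0 (phi p - phi q).
Proof.
move=> w0; apply: sumr_ge0 => p _; apply: sumr_ge0 => q _.
by rewrite mulr_ge0// le_max lexx.
Qed.

(* Discrete coarea: peel off the superlevel set {phi > 0} at its lowest level. *)
Lemma isoperimetric_sobolev (A B : seq T) (w : T -> T -> R) (K : R) (phi : T -> R) :
  (forall p q, 0 <= w p q) -> 0 <= K ->
  (forall P : pred T, (forall p, P p -> p \in A) -> has P A ->
     (count P A)%:R <= K * \sum_(p <- A | P p) \sum_(q <- B | ~~ P q) w p q) ->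
  (forall p, 0 <= phi p) -> (forall p, 0 < phi p -> p \in A) ->
  \sum_(p <- A) phi p <=
    K * \sum_(p <- A) \sum_(q <- B) w p q * Num.max 0 (phi p - phi q).
Proof.
move=> w0 K0 iso; have [n] := ubnP (count (fun p => 0 < phi p) A).
elim: n => // n IH in phi * => /ltnSE cn phi0 phiA.
have [hP|hP] := boolP (has (fun p => 0 < phi p) A); last first.
  rewrite big1_seq ?mulr_ge0// ?sum_pos_subr_ge0// => p /andP[_ pA].
  move/hasPn/(_ p pA): hP; rewrite -leNgt => h.
  by apply/eqP; rewrite eq_le h phi0.
have [p0 p0A [p00 Hp0]] : exists2 p0, p0 \in A & 0 < phi p0 /\
    forall p, p \in A -> 0 < phi p -> phi p0 <= phi p.
  elim: (A) hP => // a s IHs /=.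
  case: (boolP (has (fun p => 0 < phi p) s)) => [/IHs[p0 p0s [p00 H]] _|hs].
    have [pa|pa] := boolP ((0 < phi a) && (phi a <= phi p0)).
      move/andP: pa => [pa ap]; exists a; rewrite ?inE ?eqxx//; split => // p.
      by rewrite inE => /predU1P[->//|ps] pp; apply: le_trans ap _; exact: H.
    exists p0; rewrite ?inE ?p0s ?orbT//; split => // p.
    rewrite inE => /predU1P[-> pp|]; last exact: H.
    by move: pa; rewrite pp/= -ltNge => /ltW.
  rewrite orbF => pa; exists a; rewrite ?inE ?eqxx//; split => // p.
  rewrite inE => /predU1P[->//|ps] pp; have := hasPn hs p ps.
  by rewrite pp.
set mm := phi p0 in p00 Hp0 *.
pose P p := 0 < phi p.
pose psi p := Num.max 0 (phi p - mm).
have psiP p : P p -> phi p = mm + psi p.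
  move=> pp; rewrite /psi max_r; first by rewrite addrC subrK.
  by rewrite subr_ge0 Hp0// phiA.
have phi_eq0 p : ~~ P p -> phi p = 0.
  by rewrite -leNgt => h; apply/eqP; rewrite eq_le h phi0.
have psi_eq0 p : ~~ P p -> psi p = 0.
  by move=> /phi_eq0 E; rewrite /psi E max_l// sub0r oppr_le0 ltW.
have psi0 p : 0 <= psi p by rewrite /psi le_max lexx.
have psi_phi p : 0 < psi p -> P p.
  by move=> h; apply: contraT => /psi_eq0 E; rewrite E ltxx in h.
have IHpsi : \sum_(p <- A) psi p <=
    K * \sum_(p <- A) \sum_(q <- B) w p q * Num.max 0 (psi p - psi q).
  apply: IH => //; last by move=> p /psi_phi; exact: phiA.
  (* psi vanishes at p0, so the number of positive values drops. *)
  apply: leq_trans cn; elim: (A) p0A => // a s IHs.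
  have sub t : (count (fun p => (0 < psi p)%R) t <= count (fun p => (0 < phi p)%R) t)%N.
    by apply: sub_count => p; exact: psi_phi.
  rewrite inE => /predU1P[<-|/IHs h] /=.
    by rewrite /psi -/mm subrr maxxx ltxx p00 add0n add1n ltnS.
  rewrite -addnS leq_add//.
  by case: (boolP (0 < psi a)) => // /psi_phi; rewrite /P => ->.
have E1 s : \sum_(p <- s) phi p = (count P s)%:R * mm + \sum_(p <- s) psi p.
  elim: s => [|a s IHs]; first by rewrite !big_nil mul0r addr0.
  rewrite !big_cons IHs /=; case: (boolP (P a)) => Pa /=.
    by rewrite add1n -natr1 (psiP _ Pa) mulrDl mul1r addrACA [mm + _]addrC.
  by rewrite add0n (phi_eq0 _ Pa) (psi_eq0 _ Pa) !add0r.
(* Passing from phi to psi leaves differences inside P unchanged and lowers each difference across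
   the boundary of P by [mm]; the latter produce the isoperimetric term. *)
have E2 : \sum_(p <- A) \sum_(q <- B) w p q * Num.max 0 (phi p - phi q) =
    mm * \sum_(p <- A | P p) \sum_(q <- B | ~~ P q) w p q +
    \sum_(p <- A) \sum_(q <- B) w p q * Num.max 0 (psi p - psi q).
  rewrite mulr_sumr [X in _ = X + _]big_mkcond -big_split/=; apply: eq_bigr => p _.
  case: ifPn => Pp; last first.
    rewrite add0r; apply: eq_bigr => q _; rewrite phi_eq0// psi_eq0//.
    by rewrite !sub0r !max_l// oppr_le0.
  rewrite mulr_sumr [X in _ = X + _]big_mkcond -big_split/=; apply: eq_bigr => q _.
  case: ifPn => Pq; last first.
    move: Pq; rewrite negbK => Pq; rewrite (psiP _ Pp) (psiP _ Pq).
    by rewrite opprD addrACA subrr !add0r.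
  rewrite (psiP _ Pp) (phi_eq0 _ Pq) (psi_eq0 _ Pq) !subr0 !max_r//.
    by rewrite mulrDr mulrC.
  by rewrite addr_ge0// ltW.
rewrite E1 E2 mulrDr lerD// mulrCA [leLHS]mulrC.
by rewrite ler_wpM2l ?(ltW p00)//; apply: iso.
Qed.

End Coarea.

(** * Separated nets and edge boundaries *)

Section Lattice.
Context {R : realType} {X : pmetricType R}.

Lemma card_le_uniq_seq (T : choiceType) (A : set T) n :
  (forall s, uniq s -> (forall x, x \in s -> A x) -> (size s <= n)%N) ->
  (A #<= `I_n)%card.
Proof.
move=> H.
have fA : finite_set A.
  apply: contrapT => /(infinite_set_fset n.+1)[B BA]; apply/negP; rewrite -ltnNge.
  by rewrite ltnS; apply: H; [exact: fset_uniq|move=> x /BA].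
have [B AB] := proj1 finite_fsetP fA.
have : (#|` B| <= n)%N by apply: H; [exact: fset_uniq|move=> x xB; rewrite AB].
rewrite -card_le_II; apply: card_le_trans; rewrite AB.
by have /card_eqPle[] : ([set` B] #= `I_#|` B|)%card by apply/card_eq_fsetP.
Qed.

Definition separated (rho : R) (A : set X) :=
  forall p q, A p -> A q -> p != q -> rho <= mdist p q.

(** By Zorn: a point at distance at least rho from a maximal separated set could be added to it. *)
Lemma maximal_separated_exists (rho : R) : 0 < rho ->
  exists2 A, separated rho A & forall x, exists2 p, A p & mdist x p < rho.
Proof.
move=> rho0; have [|A [sA mA]] := @Zorn_bigcup X [set A | separated rho A].
  move=> F FS tF p q [U FU Up] [V FV Vq] pq.
  have [UV|VU] := tF U V FU FV.
    by apply: (FS V FV) => //; exact: UV.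
  by apply: (FS U FU) => //; exact: VU.
exists A => // x; apply: contrapT => nx.
have far p : A p -> rho <= mdist x p.
  by move=> Ap; rewrite leNgt; apply/negP => xp; apply: nx; exists p.
have Ax : ~ A x by move=> /far; rewrite mdistxx leNgt rho0.
apply: (mA (x |` A)).
  split; first by move=> p; right.
  by move=> /(_ x)/(_ (or_introl erefl)).
move=> p q [->|Ap] [->|Aq]; rewrite ?eqxx// => pq.
- exact: far.
- by rewrite metric_sym; exact: far.
- exact: sA.
Qed.

Variable mu : {outer_measure set X -> \bar R}.
Hypothesis borel_cara : forall A : set X, borel_set A -> mu.-caratheodory A.
Local Notation m := (cara_measure mu).

Lemma mu_ball_indic (x : X) (r : R) :
  (\int[m]_y (\1_(ball x r) y)%:E = mu (ball x r))%E.
Proof. by rewrite integral_indic ?setIT//; exact: measurable_ball_cara. Qed.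

(** Packing: the balls of radius rho / 2 around the points are disjoint, lie in the ball of radius r
    + rho around x, and have mass at least f(rho / 2) each. Disjointness enters as overlap at most
    1. *)
Lemma separated_locally_finite (rho : R) (A : set X) : 0 < rho ->
  uniform_space mu -> separated rho A ->
  exists N : R -> nat, forall (x : X) (r : R), 0 < r ->
    (A `&` ball x r #<= `I_(N r))%card.
Proof.
move=> rho0 [f [g [fg0 _ Hfg]]] sA.
have rho20 : 0 < rho / 2 by exact: divr_gt0.
have [f0 _] := fg0 _ rho20.
exists (fun r => Num.truncn (g (r + rho) / f (rho / 2))) => x r r0.
apply: card_le_uniq_seq => s us sx.
have rr0 : 0 < r + rho by exact: addr_gt0.
have [_ gr0] := fg0 _ rr0.
rewrite truncn_ge_nat ?divr_ge0 ?(ltW gr0) ?(ltW f0)// ler_pdivlMr// -lee_fin.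
pose h (y : X) := ((\1_(ball x (r + rho)) y)%:E : \bar R).
have mb z t : measurable (ball z t : set (caratheodory_type mu)).
  exact: measurable_ball_cara.
have mh : measurable_fun setT (h : caratheodory_type mu -> \bar R).
  by apply/measurable_EFinP; exact: measurable_indic.
have h0 y : (0 <= h y)%E by rewrite lee_fin.
apply: (@le_trans _ _ (\int[m]_y h y)%E); last first.
  by rewrite mu_ball_indic; case/andP: (Hfg x _ rr0).
rewrite -[leRHS]mul1e.
apply: le_trans (@overlap_integral_le _ _ _ borel_cara s (rho / 2) 1 h mh h0 _); last first.
  move=> y; rewrite -size_filter.
  case E : [seq p <- s | mdist y p < rho / 2] => [//|p [//|q t]].
  have pin : p \in [seq p <- s | mdist y p < rho / 2] by rewrite E inE eqxx.
  have qin : q \in [seq p <- s | mdist y p < rho / 2] by rewrite E !inE eqxx orbT.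
  move: pin qin; rewrite !mem_filter => /andP[yp ps] /andP[yq qs].
  have pq : p != q.
    have := filter_uniq (fun p => mdist y p < rho / 2) us.
    by rewrite E /= inE negb_or => /andP[/andP[]].
  have := sA p q (sx p ps).1 (sx q qs).1 pq.
  have := metric_triangle p y q; rewrite (metric_sym p y); lra.
apply: (@le_trans _ _ (\sum_(p <- s) (f (rho / 2))%:E)%E).
  by rewrite sumEFin lee_fin big_const_seq count_predT iter_addr_0 mulr_natl.
rewrite !big_seq; apply: lee_sum => p ps.
apply: (@le_trans _ _ (mu (ball p (rho / 2)))).
  by case/andP: (Hfg p _ rho20).
rewrite -[leLHS]mul1e -[leLHS](@integral_cst _ _ _ m)//.
apply: ge0_le_integral => //; first exact: measurable_funTS.
move=> y py; rewrite /h indicE mem_set//.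
have [_] := sx p ps; move: py; rewrite !ballEmdist/= => py xp.
by have := metric_triangle x p y; lra.
Qed.

Lemma quasi_lattice_exists (rho : R) : 0 < rho -> uniform_space mu ->
  exists2 G : set X, quasi_lattice G & forall x, exists2 p, G p & mdist x p < rho.
Proof.
move=> rho0 um; have [G sG cG] := maximal_separated_exists rho0.
exists G => //; split; last exact: separated_locally_finite sG.
exists rho => //; apply/seteqP; split => // x _ /=.
by apply/dist_to_lt; exact: cG.
Qed.

(** [non_amenable] denies amenability to every quasi-lattice, so the inequality holds on whichever
    one suits the covering by small balls. *)
Lemma non_amenable_isoperimetric (G : set X) : quasi_lattice G -> non_amenable X ->
  exists eps r : R, [/\ 0 < eps, 0 < r & forall F : {fset X}, F != fset0 ->
    [set` F] `<=` G ->
    eps <= #|` fset_set (boundary G r [set` F])|%:R / #|` F|%:R].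
Proof.
move=> qG nam; apply: contrapT => H; apply: nam; exists G => // eps r e0 r0.
apply: contrapT => H2; apply: H; exists eps, r; split => // F F0 FG.
by rewrite leNgt; apply/negP => FB; apply: H2; exists F.
Qed.

(** Turns the vertex boundary into the weighted edge boundary of [isoperimetric_sobolev]. A boundary
    point x has some p in P and some lattice point q outside P within r, hence an edge pq shorter
    than 2r; an edge is charged by at most N points x, all within r of p. B contains the
    2r-neighbours of A, so that q is counted. *)
Lemma count_le_edge_boundary (G : set X) (A B : seq X) (eps r : R) (N : nat)
    (P : pred X) :
  0 < eps -> (forall x, (G `&` ball x r #<= `I_N)%card) ->
  (forall F : {fset X}, F != fset0 -> [set` F] `<=` G ->
    eps <= #|` fset_set (boundary G r [set` F])|%:R / #|` F|%:R) ->
  uniq A -> (forall p, p \in A -> G p) ->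
  (forall p q, p \in A -> G q -> mdist p q < 2 * r -> q \in B) ->
  (forall p, P p -> p \in A) -> has P A ->
  (count P A)%:R <= N%:R / eps *
    \sum_(p <- A | P p) \sum_(q <- B | ~~ P q) (mdist p q < 2 * r)%R%:R.
Proof.
move=> e0 GN iso uA AG AB PA hP.
pose F := [fset p in A | P p]%fset.
have FE p : (p \in F) = P p.
  by rewrite !inE/=; apply/andP/idP => [[]//|Pp]; split => //; exact: PA.
have FG : [set` F] `<=` G by move=> p /=; rewrite FE => /PA/AG.
have cF : #|` F| = count P A.
  rewrite -size_filter; apply/perm_size/uniq_perm; rewrite ?fset_uniq ?filter_uniq//.
  move=> p; rewrite FE mem_filter; apply/idP/andP => [Pp|[]//].
  by split => //; exact: PA.
have F0 : F != fset0.
  by case/hasP: hP => p pA Pp; apply/fset0Pn; exists p; rewrite FE.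
have F0' : 0 < (count P A)%:R :> R by rewrite -cF ltr0n cardfs_gt0.
set D := fset_set (boundary G r [set` F]).
have finD : finite_set (boundary G r [set` F]).
  exact: boundary_finite GN.
have := iso F F0 FG; rewrite -/D cF ler_pdivlMr// => isoF.
rewrite mulrAC ler_pdivlMr// mulrC; apply: le_trans isoF _.
apply: (@le_trans _ _ (\sum_(x <- D) \sum_(p <- A | P p) \sum_(q <- B | ~~ P q)
    ((mdist p x < r)%R%:R * (mdist p q < 2 * r)%R%:R))).
  have -> : #|` D|%:R = \sum_(x <- D) 1 :> R.
    by rewrite big_const_seq count_predT iter_addr_0.
  rewrite !big_seq; apply: ler_sum => x; rewrite /D in_fset_set// inE => -[Gx].
  move=> /dist_to_lt[p /= pF xp] /dist_to_lt[q [Gq qF] xq].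
  rewrite FE in pF; have nPq : ~~ P q by apply/negP => Pq; apply: qF; rewrite /= FE.
  have pq : mdist p q < 2 * r.
    by have := metric_triangle p x q; rewrite (metric_sym p x); lra.
  have pA := PA _ pF; have qB := AB _ _ pA Gq pq.
  rewrite (big_rem p)//= pF (big_rem q)//= nPq pq (metric_sym p x) xp mulr1.
  rewrite -addrA lerDl addr_ge0//.
    by apply: sumr_ge0 => q' _; rewrite mulr_ge0.
  by apply: sumr_ge0 => p' _; apply: sumr_ge0 => q' _; rewrite mulr_ge0.
rewrite exchange_big/= mulr_sumr; apply: ler_sum => p Pp.
rewrite exchange_big/= mulr_sumr; apply: ler_sum => q Pq.
rewrite -mulr_suml ler_wpM2r//.
have : (count (fun x => (mdist p x < r)%R) D <= N)%N.
  apply: (@count_near_le _ _ G) => //; first exact: fset_uniq.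
  by move=> x; rewrite /D in_fset_set// inE => -[].
rewrite -(ler_nat R); apply: le_trans.
by rewrite -sum1_count natr_sum [leRHS]big_mkcond; apply: ler_sum => x _; case: ifP.
Qed.

End Lattice.

(** * Non-amenability implies the Sobolev inequality *)

Section Chain.
Context {R : realType} {X : pmetricType R}.

(** The curve from p to q has length at most Q D; it is cut into k arcs of equal length, shorter
    than rho. The reach D' = Q D bounds its distance from p. Neither constant depends on Phi, p or
    q. *)
Lemma quasiconvex_chain (D rho : R) : quasiconvex X -> 0 < rho -> 0 < D ->
  exists (k : nat) (D' : R), 0 < D' /\ forall (Phi : X -> R) (p q : X) (M : R),
    mdist p q < D ->
    (forall x y, mdist p x <= D' -> mdist x y < rho -> `|Phi x - Phi y| <= M) ->
    `|Phi p - Phi q| <= k%:R * M.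
Proof.
move=> [Q Q1 Hqc] rho0 D0; have Q0 : 0 < Q by exact: lt_le_trans Q1.
pose k := (Num.truncn (Q * D / rho)).+1.
have kD : Q * D < k%:R * rho by rewrite -ltr_pdivrMr// truncnS_gt.
exists k, (Q * D); split; first exact: mulr_gt0.
move=> Phi p q M pq HM; have [c [rc cp cq clen_le]] := Hqc p q.
have [a0 aL] := arc_ends rc; rewrite cp in a0; rewrite cq in aL.
set L := clen c (curve_r c) in aL.
have LQ : L <= Q * mdist p q.
  by rewrite -lee_fin -/L; move: clen_le; rewrite curve_lengthE.
have LD : L <= Q * D by apply: le_trans LQ _; rewrite ler_pM2l// ltW.
have L0 : 0 <= L by exact: clen_ge0.
have k0 : 0 < k%:R :> R by rewrite ltr0n.
pose s i : R := i%:R * (L / k%:R).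
have Lk0 : 0 <= L / k%:R by rewrite divr_ge0// ltW.
have s0 i : 0 <= s i by rewrite mulr_ge0.
have sk : s k = L by rewrite /s mulrC divfK// gt_eqF.
have sS i : s i.+1 = s i + L / k%:R by rewrite /s -natr1 mulrDl mul1r.
have sL i : (i <= k)%N -> s i <= L by move=> ik; rewrite -[leRHS]sk ler_wpM2r ?ler_nat.
have key i : (i <= k)%N ->
    `|Phi p - Phi (arc_length_param c (s i))| <= i%:R * M.
  elim: i => [_|i IH ik]; first by rewrite /s !mul0r a0 subrr normr0.
  rewrite -natr1 mulrDl mul1r.
  apply: le_trans (_ : `|Phi p - Phi (arc_length_param c (s i))| +
     `|Phi (arc_length_param c (s i)) - Phi (arc_length_param c (s i.+1))| <= _).
    by apply: le_trans (ler_normD _ _); rewrite addrA subrK.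
  apply: lerD; first by apply: IH; exact: ltnW.
  apply: HM.
    rewrite -a0; apply: le_trans (mdist_arc rc (lexx 0) (s0 i) (sL i (ltnW ik))) _.
    by rewrite subr0; apply: le_trans (sL i (ltnW ik)) _.
  apply: le_lt_trans (mdist_arc rc (s0 i) _ (sL _ ik)) _; first by rewrite sS lerDl.
  rewrite sS addrAC subrr add0r ltr_pdivrMr// mulrC.
  exact: le_lt_trans kD.
by have := key k (leqnn k); rewrite sk aL.
Qed.

End Chain.

(** * Averages over balls *)

Section Poincare.
Context {R : realType} {X : pmetricType R}.
Variable mu : {outer_measure set X -> \bar R}.
Hypothesis borel_cara : forall A : set X, borel_set A -> mu.-caratheodory A.
Local Notation m := (cara_measure mu).

Definition avg (v : X -> R) (x : X) (r : R) : R :=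
  fine (\int[m]_(y in ball x r) (v y)%:E)%E / fine (mu (ball x r)).

Lemma meanE (v : X -> \bar R) (A : set X) (b I : R) :
  0 < b -> mu A = b%:E -> (\int[m]_(y in A) v y = I%:E)%E ->
  mean mu v A = (I / b)%:E.
Proof.
by move=> b0 Ab vI; rewrite /mean Ab vI inver gt_eqF// -EFinM mulrC.
Qed.

(** Compares the average over a small ball with the mean a over a larger one, whose deviation the
    Poincare inequality controls. *)
Lemma avg_deviation (v : X -> R) (x z : X) (r r2 a f : R) : 0 < f ->
  (f%:E <= mu (ball x r))%E -> (mu (ball x r) < +oo)%E ->
  ball x r `<=` ball z r2 -> m.-integrable (ball z r2) (EFin \o v) ->
  (`|avg v x r - a|%:E <= (f^-1)%:E * \int[m]_(y in ball z r2) `|v y - a|%:E)%E.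
Proof.
move=> f0 fb bfin sub iv.
have mb y s : measurable (ball y s : set (caratheodory_type mu)).
  exact: measurable_ball_cara.
have iv1 : m.-integrable (ball x r) (EFin \o v) by exact: integrableS iv.
have [b bE] : exists b, mu (ball x r) = b%:E.
  exists (fine (mu (ball x r))); rewrite fineK// ge0_fin_numE//.
have b0 : 0 < b by apply: lt_le_trans f0 _; rewrite -lee_fin -bE.
have fb' : f <= b by rewrite -lee_fin -bE.
set I1 := (\int[m]_(y in ball x r) (v y)%:E)%E.
have I1fin : I1 \is a fin_num by exact: integrable_fin_num iv1.
have ica : m.-integrable (ball x r) (EFin \o cst a).
  apply/integrableP; split; first by apply/measurable_EFinP; exact: measurable_cst.
  rewrite (eq_integral (cst `|a|%:E))// (@integral_cst _ _ _ m)//.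
  by rewrite -[m _]/(mu (ball x r)) bE -EFinM ltry.
have E : (\int[m]_(y in ball x r) (v y - a)%:E = (fine I1 - a * b)%:E)%E.
  rewrite EFinB fineK// EFinM -bE -(@integral_cst _ _ _ m (ball x r) (mb _ _) a%:E).
  exact: integralB_EFin.
have -> : avg v x r - a = (fine I1 - a * b) / b.
  by rewrite /avg bE /= mulrBl mulfK// gt_eqF.
rewrite normrM normfV (gtr0_norm b0) mulrC EFinM.
have h1 : (`|fine I1 - a * b|%:E <= \int[m]_(y in ball x r) `|v y - a|%:E)%E.
  rewrite -[leLHS]/(`|(fine I1 - a * b)%:E|)%E -E.
  apply: le_abse_integral => //.
  apply: measurable_int; exact: (integrableB (mb _ _) iv1 ica).
have mva : measurable_fun (ball z r2 : set (caratheodory_type mu))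
    (fun y => `|v y - a|%:E : \bar R).
  apply/measurable_EFinP; apply: measurableT_comp => //.
  apply: measurable_funB => //; apply/measurable_EFinP; exact: measurable_int iv.
apply: lee_pmul => //; rewrite ?lee_fin ?invr_ge0 ?(ltW b0)//.
  by rewrite lef_pV2.
apply: le_trans h1 _; exact: ge0_subset_integral.
Qed.

(** The Poincare inequality with denominators cleared; the ratio b / t <= 1 of the two masses is
    absorbed. *)
Lemma poincare_integral (CP r tau : R) (v : X -> R) (g : X -> \bar R) (x : X)
    (b t a I : R) :
  0 <= CP -> 0 < r -> 0 < b -> b <= t ->
  mu (ball x r) = b%:E -> mu (ball x (tau * r)) = t%:E ->
  (forall y, (0 <= g y)%E) ->
  (\int[m]_(y in ball x (tau * r)) g y = I%:E)%E ->
  (mean mu (fun y => `|(v y)%:E - a%:E|)%E (ball x r)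
     <= (CP * r)%:E * mean mu g (ball x (tau * r)))%E ->
  (\int[m]_(y in ball x r) `|v y - a|%:E <= (CP * r * I)%:E)%E.
Proof.
move=> CP0 r0 b0 bt bE tE g0 IE.
have t0 : 0 < t by exact: lt_le_trans bt.
have I0 : 0 <= I by rewrite -lee_fin -IE; exact: integral_ge0.
rewrite (meanE t0 tE IE) /mean bE inver gt_eqF//.
rewrite (_ : (\int[m]_(y in ball x r) `|(v y)%:E - a%:E|)%E =
  (\int[m]_(y in ball x r) `|v y - a|%:E)%E)//.
have : (0 <= \int[m]_(y in ball x r) `|v y - a|%:E)%E.
  by apply: integral_ge0 => y _; rewrite lee_fin.
case: (\int[m]_(y in ball x r) _)%E => [J| |] //.
  rewrite !lee_fin => J0; rewrite mulrC ler_pdivrMr// => /le_trans; apply.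
  rewrite -(mulrA (CP * r)) ler_wpM2l ?mulr_ge0 ?(ltW r0)//.
  by rewrite mulrAC ler_pdivrMr// ler_wpM2l.
(* An infinite left side is excluded by the finite right side. *)
by move=> _; rewrite gt0_muley ?lte_fin ?invr_gt0// leye_eq.
Qed.

End Poincare.

(** * The Sobolev inequality for nonnegative real functions *)

Section NonAmenableSobolev.
Context {R : realType} {X : pmetricType R}.
Variable mu : {outer_measure set X -> \bar R}.
Hypothesis borel_cara : forall A : set X, borel_set A -> mu.-caratheodory A.
Local Notation m := (cara_measure mu).

(** Both averages are compared with the mean over the ball of radius [RP] around x: with rho =
    [RP / 2] it contains the balls of radius rho around x and y. The radius s = [tau * RP] comes
    from the right side of the Poincare inequality. *)
Lemma poincare_avg : uniform_space mu -> local_weak_poincare mu ->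
  exists rho s C1 : R, [/\ 0 < rho, 0 < s, 0 <= C1 &
    forall (v : X -> R) (g : X -> \bar R),
      minimal_weak_upper_gradient mu (EFin \o v) g ->
      m.-integrable setT (EFin \o v) ->
      (\int[m]_x g x < +oo)%E ->
      forall x y, mdist x y < rho ->
        `|avg mu v x rho - avg mu v y rho| <=
        C1 * fine (\int[m]_(z in ball x s) g z)%E].
Proof.
move=> [f [h [fh0 fhm Hfh]]] [CP [RP [tau [CP0 RP0 tau1 HP]]]].
pose rho := RP / 2; have rho0 : 0 < rho by exact: divr_gt0.
have [f0 _] := fh0 _ rho0.
have tau0 : 0 < tau by exact: lt_le_trans tau1.
have s0 : 0 < tau * RP by exact: mulr_gt0.
exists rho, (tau * RP), (2 * (f rho)^-1 * (CP * RP)); split => //.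
  by rewrite !mulr_ge0 ?invr_ge0 ?(ltW f0) ?(ltW CP0) ?(ltW RP0).
move=> v g gmin iv fg x y xy.
have [[mg g0 _] gb _] := gmin.
have mb z t : measurable (ball z t : set (caratheodory_type mu)).
  exact: measurable_ball_cara.
have [|_ HPx] := HP x RP; first by rewrite RP0 lexx.
have mufin z t : 0 < t -> exists2 b, 0 < b & mu (ball z t) = b%:E.
  move=> t0; have /andP[h1 h2] := Hfh z _ t0; have [ft _] := fh0 _ t0.
  have hfin : mu (ball z t) \is a fin_num.
    rewrite ge0_fin_numE ?outer_measure_ge0//; exact: le_lt_trans h2 (ltry _).
  exists (fine (mu (ball z t))); last by rewrite fineK.
  by rewrite -lte_fin fineK//; apply: lt_le_trans h1; rewrite lte_fin.
have [b b0 bE] := mufin x _ RP0.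
have [t t0 tE] := mufin x _ s0.
have sub1 : ball x RP `<=` ball x (tau * RP).
  move=> z; rewrite !ballEmdist/= => /lt_le_trans; apply.
  by rewrite ler_peMl// ltW.
have bt : b <= t by rewrite -lee_fin -bE -tE; exact: le_outer_measure.
have ivb z u : m.-integrable (ball z u) (EFin \o v) by exact: integrableS iv.
pose I0 := fine (\int[m]_(y in ball x RP) (v y)%:E)%E.
have I0E : (\int[m]_(y in ball x RP) (v y)%:E = I0%:E)%E.
  by rewrite /I0 fineK//; exact: integrable_fin_num (ivb _ _).
pose a := I0 / b.
have meana : mean mu (EFin \o v) (ball x RP) = a%:E by exact: meanE bE I0E.
set I := fine _.
have IE : (\int[m]_(y in ball x (tau * RP)) g y = I%:E)%E.
  by rewrite /I fineK// ge0_fin_numE ?gb// integral_ge0.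
have := HPx v (ivb _ _) g gmin; rewrite meana => HP'.
have J := poincare_integral (ltW CP0) RP0 b0 bt bE tE g0 IE HP'.
have dev z : ball z rho `<=` ball x RP ->
    `|avg mu v z rho - a| <= (f rho)^-1 * (CP * RP * I).
  move=> sub; rewrite -lee_fin EFinM.
  have /andP[h1 h2] := Hfh z _ rho0.
  apply: le_trans (@avg_deviation _ _ _ borel_cara v z x rho RP a (f rho)
    f0 h1 _ sub (ivb _ _)) _.
    exact: le_lt_trans h2 (ltry _).
  by apply: lee_wpmul2l => //; rewrite lee_fin invr_ge0 ltW.
have d1 : `|avg mu v x rho - a| <= (f rho)^-1 * (CP * RP * I).
  apply: dev => z; rewrite !ballEmdist/= => /lt_trans; apply.
  by rewrite /rho ltr_pdivrMr// ltr_pMr// ltr1n.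
have d2 : `|avg mu v y rho - a| <= (f rho)^-1 * (CP * RP * I).
  apply: dev => z; rewrite !ballEmdist/= => yz.
  have := metric_triangle x y z; rewrite /rho in xy yz; lra.
rewrite distrC in d2.
have := ler_normD (avg mu v x rho - a) (a - avg mu v y rho).
rewrite addrA subrK => /le_trans; apply; apply: le_trans (lerD d1 d2) _.
by set fi := (f rho)^-1; rewrite le_eqVlt; apply/orP; left; apply/eqP; ring.
Qed.

Lemma integral_le_sum_balls (v : X -> R) (A : seq X) (rho : R) :
  measurable_fun setT (EFin \o v : caratheodory_type mu -> \bar R) ->
  (forall x, 0 <= v x) ->
  (forall x, v x != 0 -> exists2 p, p \in A & mdist p x < rho) ->
  (\int[m]_x (v x)%:E <= \sum_(p <- A) \int[m]_(x in ball p rho) (v x)%:E)%E.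
Proof.
move=> mv v0 cov.
have mb z t : measurable (ball z t : set (caratheodory_type mu)).
  exact: measurable_ball_cara.
have hb0 p x : (0 <= ((EFin \o v) \_ (ball p rho)) x)%E.
  by rewrite patchE; case: ifPn => // _; rewrite lee_fin.
have mhb p : measurable_fun setT
    ((EFin \o v) \_ (ball p rho) : caratheodory_type mu -> \bar R).
  by apply: (proj1 (measurable_restrictT _ (mb _ _))); exact: measurable_funTS.
under eq_bigr do rewrite integral_mkcond.
rewrite -ge0_integral_sum//; apply: ge0_le_integral => //.
- by move=> x _; rewrite lee_fin.
- exact: emeasurable_sum.
move=> x _; have [->|/cov[p pA px]] := eqVneq (v x) 0.
  by apply: sume_ge0.
rewrite (big_rem p)//= patchE mem_set ?ballEmdist//.
by rewrite leeDl// sume_ge0.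
Qed.

Theorem sobolev_real : uniform_space mu -> quasiconvex X -> local_weak_poincare mu ->
  non_amenable X ->
  exists2 C : R, 0 < C & forall (v : X -> R) (g : X -> \bar R) (x0 : X) (rs : R),
    minimal_weak_upper_gradient mu (EFin \o v) g ->
    m.-integrable setT (EFin \o v) -> (\int[m]_x g x < +oo)%E ->
    (forall x, 0 <= v x) -> 0 < rs -> (forall x, v x != 0 -> ball x0 rs x) ->
    (\int[m]_x (v x)%:E <= C%:E * \int[m]_x g x)%E.
Proof.
move=> um qc pw nam; have [rho [s [C1 [rho0 s0 C10 Havg]]]] := poincare_avg um pw.
have [G qG covG] := quasi_lattice_exists borel_cara rho0 um.
have [eps [r [eps0 r0 iso]]] := non_amenable_isoperimetric qG nam.
have [_ [N GN]] := qG.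
have r20 : 0 < 2 * r by exact: mulr_gt0.
have [k [D [D0 chain]]] := quasiconvex_chain qc rho0 r20.
have [f [h [fh0 _ Hfh]]] := um.
have [_ h0] := fh0 _ rho0.
have DS0 : 0 < D + s by exact: addr_gt0.
pose K : R := (N r)%:R / eps.
have K0 : 0 <= K by rewrite divr_ge0// ltW.
(* The factors are: the mass of a small ball, the isoperimetric constant, the number of
   2r-neighbours of a lattice point, the links of a chain times the Poincare estimate for one link,
   and the overlap of the balls of radius D + s. *)
pose M : R := h rho * (K * ((N (2 * r))%:R * (k%:R * C1) * (N (D + s))%:R)).
have M0 : 0 <= M by apply: mulr_ge0; [exact: ltW|rewrite mulr_ge0// !mulr_ge0].
exists (M + 1); first by rewrite ltr_wpDl.
move=> v g x0 rs gmin iv fg v0 rs0 supp.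
have [[mg g0 _] gb _] := gmin.
have mb z t : measurable (ball z t : set (caratheodory_type mu)).
  exact: measurable_ball_cara.
have rA0 : 0 < rs + rho by exact: addr_gt0.
have rB0 : 0 < rs + rho + 2 * r by exact: addr_gt0.
have finA t : 0 < t -> finite_set (G `&` ball x0 t).
  by move=> t0; apply/finite_set_leP; exists (N t); exact: GN.
(* A holds the lattice points whose balls can meet the support; B holds in addition their
   2r-neighbours, as [count_le_edge_boundary] requires. *)
pose A : seq X := fset_set (G `&` ball x0 (rs + rho)).
pose B : seq X := fset_set (G `&` ball x0 (rs + rho + 2 * r)).
have inA p : p \in A <-> G p /\ mdist x0 p < rs + rho.
  rewrite /A in_fset_set; last exact: finA.
  by split => [/set_mem[Gp]|[Gp xp]]; [|apply/mem_set; split => //]; rewrite ballEmdist.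
have inB p : p \in B <-> G p /\ mdist x0 p < rs + rho + 2 * r.
  rewrite /B in_fset_set; last exact: finA.
  by split => [/set_mem[Gp]|[Gp xp]]; [|apply/mem_set; split => //]; rewrite ballEmdist.
have uA : uniq A by exact: fset_uniq.
have uB : uniq B by exact: fset_uniq.
pose J p := fine (\int[m]_(z in ball p (D + s)) g z)%E.
have JE p : (\int[m]_(z in ball p (D + s)) g z = (J p)%:E)%E.
  by rewrite /J fineK// ge0_fin_numE ?gb// integral_ge0.
have J0 p : 0 <= J p by rewrite -lee_fin -JE integral_ge0.
have avg0 p : 0 <= avg mu v p rho.
  apply: divr_ge0; apply: fine_ge0; last exact: outer_measure_ge0.
  by apply: integral_ge0 => x _; rewrite lee_fin.
(* The cutoff gives phi the support that [isoperimetric_sobolev] asks for; at lattice points it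
   changes nothing, since the averages outside A vanish. *)
pose phi p := if p \in A then avg mu v p rho else 0.
have phiE p : G p -> phi p = avg mu v p rho.
  move=> Gp; rewrite /phi; case: ifPn => // pA.
  rewrite /avg (eq_integral (cst 0%E)) ?integral0 ?mul0r// => y.
  rewrite inE ballEmdist/= => py; congr EFin; apply/eqP; apply: contraT => /supp.
  rewrite ballEmdist/= => xy; case/negP: pA; apply/inA; split => //.
  by have := metric_triangle x0 y p; rewrite (metric_sym y p); lra.
pose w (p q : X) : R := (mdist p q < 2 * r)%R%:R.
have sob : \sum_(p <- A) phi p <=
    K * \sum_(p <- A) \sum_(q <- B) w p q * Num.max 0 (phi p - phi q).
  apply: isoperimetric_sobolev => //.
  - move=> P PA hP; apply: (@count_le_edge_boundary _ _ G) => //.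
    + by move=> x; exact: GN.
    + by move=> p /inA[].
    + move=> p q /inA[Gp xp] Gq pq; apply/inB; split => //.
      by have := metric_triangle x0 p q; lra.
  - by move=> p; rewrite /phi; case: ifP.
  - by move=> p; rewrite /phi; case: ifP; rewrite ?ltxx.
(* Each link of the chain integrates g over a ball of radius s centred within D of p, hence inside
   the ball of radius D + s around p. *)
have diff p q : p \in A -> q \in B -> w p q * Num.max 0 (phi p - phi q) <=
    w p q * (k%:R * (C1 * J p)).
  move=> /inA[Gp _] /inB[Gq _]; rewrite /w; case: ltP => pq; last by rewrite !mul0r.
  rewrite !mul1r ge_max; apply/andP; split; first by rewrite !mulr_ge0.
  rewrite !phiE//; apply: le_trans (ler_norm _) _.
  apply: (chain (fun x => avg mu v x rho)) => // x y px xy.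
  apply: le_trans (Havg v g gmin iv fg x y xy) _.
  rewrite ler_wpM2l// -lee_fin -JE fineK; last first.
    by rewrite ge0_fin_numE ?gb// integral_ge0.
  apply: ge0_subset_integral => //.
    by apply: measurable_funTS; exact: borel_fun_measurable.
  move=> z; rewrite !ballEmdist/= => xz.
  by have := metric_triangle p x z; lra.
have cB p : \sum_(q <- B) w p q <= (N (2 * r))%:R.
  have : (count (fun q => (mdist p q < 2 * r)%R) B <= N (2 * r)%R)%N.
    apply: (@count_near_le _ _ G) => //; last exact: GN.
    by move=> q /inB[].
  rewrite -(ler_nat R); apply: le_trans.
  rewrite -sum1_count natr_sum [leRHS]big_mkcond; apply: ler_sum => q _.
  by rewrite /w; case: ifP.
have sumJ : (\sum_(p <- A) (J p)%:E <= (N (D + s)%R)%:R%:E * \int[m]_x g x)%E.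
  under eq_bigr do rewrite -JE.
  apply: overlap_integral_le => //; first exact: borel_fun_measurable.
  move=> x; apply: (@count_near_le _ _ G) => //; last exact: GN.
  by move=> p /inA[].
have sumphi : \sum_(p <- A) phi p <=
    K * ((N (2 * r))%:R * (k%:R * C1) * \sum_(p <- A) J p).
  apply: le_trans sob _; rewrite ler_wpM2l// mulr_sumr !big_seq.
  apply: ler_sum => p pA.
  apply: (@le_trans _ _ (\sum_(q <- B) w p q * (k%:R * (C1 * J p)))).
    by rewrite !big_seq; apply: ler_sum => q qB; exact: diff.
  rewrite -mulr_suml -!mulrA ler_wpM2r//.
  by rewrite !mulr_ge0.
have [Ig IgE] : exists Ig, (\int[m]_x g x = Ig%:E)%E.
  by exists (fine (\int[m]_x g x)); rewrite fineK// ge0_fin_numE// integral_ge0.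
have Ig0 : 0 <= Ig by rewrite -lee_fin -IgE integral_ge0.
rewrite IgE -EFinM in sumJ *.
rewrite sumEFin lee_fin in sumJ.
apply: le_trans (@integral_le_sum_balls v A rho _ v0 _) _.
- exact: measurable_int iv.
- move=> x /supp; rewrite ballEmdist/= => xx.
  have [p Gp xp] := covG x; exists p; last by rewrite metric_sym.
  apply/inA; split => //; have := metric_triangle x0 x p; lra.
apply: (@le_trans _ _ (\sum_(p <- A) (h rho * phi p)%:E)%E).
  rewrite !big_seq; apply: lee_sum => p /[dup] pA /inA[Gp _].
  rewrite phiE//; have /andP[hl hu] := Hfh p _ rho0.
  have [b bE] : exists b, mu (ball p rho) = b%:E.
    exists (fine (mu (ball p rho))); rewrite fineK// ge0_fin_numE ?outer_measure_ge0//.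
    exact: le_lt_trans hu (ltry _).
  have [f0 _] := fh0 _ rho0.
  rewrite bE !lee_fin in hl hu; have b0 : 0 < b by exact: lt_le_trans hl.
  have Ifin : (\int[m]_(x in ball p rho) (v x)%:E)%E \is a fin_num.
    by apply: integrable_fin_num => //; exact: integrableS iv.
  rewrite -(fineK Ifin) lee_fin.
  have -> : fine (\int[m]_(x in ball p rho) (v x)%:E)%E = b * avg mu v p rho.
    by rewrite /avg bE /= mulrC divfK// gt_eqF.
  by rewrite ler_wpM2r.
rewrite sumEFin lee_fin -mulr_sumr.
apply: (@le_trans _ _ (M * Ig)); last by rewrite ler_wpM2r// lerDl.
rewrite /M -mulrA ler_wpM2l ?(ltW h0)//.
apply: le_trans sumphi _; rewrite -[leRHS]mulrA ler_wpM2l//.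
by rewrite -[leRHS]mulrA ler_wpM2l// !mulr_ge0.
Qed.

End NonAmenableSobolev.

(** * From real functions to extended real ones *)

Section Truncation.
Context {R : realType} {X : pmetricType R}.
Variable mu : {outer_measure set X -> \bar R}.
Local Notation m := (cara_measure mu).

(* The Poincare inequality is stated for real functions only, hence the
   truncation; min(|u|, k) is finite also where u is infinite. *)
Definition trunc_abs (k : nat) (a : \bar R) : R := fine (mine `|a|%E k%:R%:E).

Lemma trunc_absE k a : (trunc_abs k a)%:E = mine `|a|%E k%:R%:E.
Proof.
rewrite /trunc_abs fineK// ge0_fin_numE.
  by rewrite gt_min ltry orbT.
by rewrite le_min abse_ge0 lee_fin ler0n.
Qed.

(** If a or b is infinite, then [|a - b|] is +oo; on finite values the truncation is a composition
    of two 1-Lipschitz maps. *)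
Lemma trunc_abs_lipschitz k (a b : \bar R) :
  (`|(trunc_abs k a)%:E - (trunc_abs k b)%:E| <= `|a - b|)%E.
Proof.
case: a b => [a| |] [b| |]; rewrite ?leey//.
have tE (c : R) : trunc_abs k c%:E = Num.min `|c| k%:R.
  by apply: EFin_inj; rewrite trunc_absE/= EFin_min.
rewrite !tE -!EFinB/= lee_fin.
apply: (@le_trans _ _ `| `|a| - `|b| |); last exact: ler_dist_dist.
by rewrite ![Num.min _ k%:R]minC; exact: ler_dist_min.
Qed.

Lemma cvg_mine_nat (a : \bar R) : (0 <= a)%E -> (fun n => mine a n%:R%:E) @ \oo --> a.
Proof.
case: a => [a _| _|//].
  apply: cvg_near_cst; exists (Num.truncn a).+1 => // n /= an.
  rewrite min_l// lee_fin; apply: le_trans (ltW (truncnS_gt a)) _.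
  by rewrite ler_nat.
apply/cvgeyPge => A; exists (Num.truncn A).+1 => // n /= an.
rewrite min_r ?leey// lee_fin; apply: le_trans (ltW (truncnS_gt A)) _.
by rewrite ler_nat.
Qed.

Lemma weak_upper_gradient_trunc_abs k (u g : X -> \bar R) :
  weak_upper_gradient mu u g ->
  weak_upper_gradient mu (EFin \o (trunc_abs k \o u)) g.
Proof.
move=> [mg g0 [S S0 HS]]; split => //; exists S => // c rc Sc Lc.
by apply: le_trans (HS c rc Sc Lc); exact: trunc_abs_lipschitz.
Qed.

Theorem non_amenable_S11 : metric_measure_space mu -> quasiconvex X ->
  uniform_space mu -> local_weak_poincare mu -> non_amenable X -> S11 mu.
Proof.
move=> [[borel_cara _] _ _] qc um pw nam.
have [C C0 HC] := sobolev_real borel_cara um qc pw nam.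
exists C => // u [iu _] [x0 [r Hr]] g gmin.
have [wg gb _] := gmin; have [mg g0 _] := wg.
(* A minimal weak upper gradient is a priori integrable on balls only; if its integral is infinite,
   the claim is trivial as C > 0. *)
have [fg|] := ltP (\int[m]_x g x)%E +oo%E; last first.
  by rewrite leye_eq => /eqP ->; rewrite gt0_muley ?lte_fin// leey.
have mu_ := measurable_int _ iu.
have mabs : measurable_fun setT (fun x : caratheodory_type mu => `|u x|%E).
  exact: measurableT_comp.
have key k : (\int[m]_x mine `|u x| k%:R%:E <= C%:E * \int[m]_x g x)%E.
  set v := trunc_abs k \o u.
  have vE : EFin \o v = (fun x => mine `|u x|%E k%:R%:E).
    by apply/funext => x; rewrite /v /= trunc_absE.
  have v0 x : 0 <= v x.
    by rewrite -lee_fin [leRHS]trunc_absE le_min abse_ge0 lee_fin ler0n.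
  have wv := weak_upper_gradient_trunc_abs k wg.
  have [gk gkmin] := minimal_weak_upper_gradient_exists borel_cara wv fg.
  have [[mgk gk0 _] _ Hgk] := gkmin.
  (* g is also a weak upper gradient of the truncation and integrable on balls, so the minimality of
     gk applies to it. *)
  have gkg : (\int[m]_x gk x <= \int[m]_x g x)%E.
    apply: ae_ge0_le_integral => //.
    - exact: borel_fun_measurable.
    - exact: borel_fun_measurable.
    - have [N [mN N0 HN]] := Hgk _ wv gb; exists N; split => // x /= H.
      by apply: HN => /= H2; apply: H.
  have iv : m.-integrable setT (EFin \o v).
    apply: le_integrable iu => //; first by rewrite vE; exact: measurable_mine.
    move=> x _; rewrite vE gee0_abs ?le_min ?abse_ge0 ?lee_fin ?ler0n//.
    by rewrite ge_min lexx.
  apply: (@le_trans _ _ (C%:E * \int[m]_x gk x)%E); last first.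
    by rewrite lee_wpmul2l// lee_fin ltW.
  rewrite (_ : (fun x => _) = EFin \o v)//.
  (* [bounded_support] allows r <= 0 when the support is empty, whereas [HC] takes a positive
     radius. *)
  apply: (HC v gk x0 (Num.max 1 r)) => //.
  - exact: le_lt_trans gkg fg.
  - by rewrite lt_max ltr01.
  - move=> x vx; have /Hr : closure [set y | u y != 0%E] x.
      apply: subset_closure => /=; apply: contra vx => /eqP ux.
      by apply/eqP/EFin_inj; rewrite trunc_absE ux abse0 min_l// lee_fin.
    by rewrite !ballEmdist/= => /lt_le_trans; apply; rewrite le_max lexx orbT.
pose F n (x : caratheodory_type mu) := mine `|u x|%E (n%:R : R)%:E.
have mF n : measurable_fun setT (F n) by exact: measurable_mine.
have F0 n x : setT x -> (0 <= F n x)%E by rewrite le_min abse_ge0 lee_fin ler0n.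
have ndF x : setT x -> nondecreasing_seq (F ^~ x).
  by move=> _ n k nk; rewrite le_min !ge_min lexx/= lee_fin ler_nat nk orbT.
have cvgF := @cvg_monotone_convergence _ _ _ m setT measurableT F mF F0 ndF.
have -> : (\int[m]_x `|u x| = \int[m]_x limn (F ^~ x))%E.
  apply: eq_integral => x _; apply/esym/cvg_lim => //.
  exact: cvg_mine_nat.
rewrite -(cvg_lim _ cvgF)//; apply: lime_le; last exact: nearW.
by apply/cvg_ex; eexists; exact: cvgF.
Qed.

End Truncation.

Theorem corollaryD (R : realType) (X : pmetricType R)
    (mu : {outer_measure set X -> \bar R}) :
  metric_measure_space mu -> quasiconvex X -> uniform_space mu ->
  local_weak_poincare mu ->
  non_amenable X <-> S11 mu.
Proof.
move=> mms qc um pw; split; first exact: non_amenable_S11.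
exact: S11_non_amenable.
Qed.
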